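(* Let $(q_n)$ be a sequence of positive integers with $q_n/n\to0$ and $q_n\asymp(\log n)^{\delta_2}$ for some $\delta_2>0$. Let $X_i=\theta_i+\epsilon_i$, $i=1,\dots,n$, with $\epsilon_i$ i.i.d. $N(0,1)$, write $\mathbf X=(X_1,\dots,X_n)$, and consider testing $H_{0i}:\theta_i=0$ against $H_{1i}:\theta_i\neq0$ simultaneously for $i=1,\dots,n$ with the full Bayes rule $\boldsymbol\psi=(\psi_1,\dots,\psi_n)$, $$\psi_i=\mathbf 1\Bigl\{\mathbb E(1-\kappa_i\mid\mathbf X)>\tfrac12\Bigr\},$$ where $\mathbb E(1-\kappa_i\mid\mathbf X)$ (defined in the context) is the posterior mean of $1-\kappa_i$ under the hierarchical one-group prior with exponent $a=\tfrac12$, slowly varying function $L$, and prior density $\pi_2$ (which may depend on $n$) on the global parameter $\tau$. Assume that $L$ satisfies (A1) and (A2) of the context, and that $\pi_2$ satisfies $\int_{1/n}^{\alpha_n}\pi_2(\tau)\,d\tau=1$, where $\alpha_n=c\,(\log n)^{\delta_3}/n$ for some constants $c>0$ and $0<\delta_3<\tfrac12$ (so that $\alpha_n\to0$ and $n\alpha_n\to\infty$). Then for every fixed $b\in\mathbb R$, $$\frac1{q_n}\sup_{\boldsymbol\theta\in\boldsymbol\Theta_b}\mathbb E_{\boldsymbol\theta}\,\mathcal L(\boldsymbol\theta,\boldsymbol\psi)=1-\Phi(b)+o(1)\qquad (n\to\infty),$$ where $\mathcal L$ is the classification loss and $\boldsymbol\Theta_b$ the beta-min class defined in the context. The same conclusion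 holds with $b$ replaced by any real sequence $b=b_n\to\infty$.
   Context: Hierarchical one-group shrinkage prior: $\tau$ has density $\pi_2$; given $\tau$, independently over $i$, $\theta_i\mid\lambda_i,\tau\sim N(0,\lambda_i^2\tau^2)$ and $\lambda_i^2$ has probability density $\pi_1(t)=K\,t^{-a-1}L(t)$ on $(0,\infty)$, where $a>0$, $L:(0,\infty)\to(0,\infty)$ is measurable, continuous and slowly varying (at infinity), and $K>0$ is the normalizing constant; $a$ and $L$ do not depend on $n$. (Horseshoe-type priors are those with $a=\tfrac12$.) The condition $1/n<\alpha_n$ is understood for all sufficiently large $n$. Shrinkage coefficient: $\kappa_i=1/(1+\lambda_i^2\tau^2)$. For fixed $\tau$, $\mathbb E(1-\kappa_i\mid X_i,\tau)$ denotes the posterior mean of $1-\kappa_i$ given $X_i$ under $X_i\mid\theta_i\sim N(\theta_i,1)$; explicitly $$\mathbb E(1-\kappa_i\mid X_i=x,\tau)=\frac{\int_0^\infty \frac{t\tau^2}{1+t\tau^2}(1+t\tau^2)^{-1/2}e^{-x^2/(2(1+t\tau^2))}\,t^{-a-1}L(t)\,dt}{\int_0^\infty (1+t\tau^2)^{-1/2}e^{-x^2/(2(1+t\tau^2))}\,t^{-a-1}L(t)\,dt}.$$ The full Bayes coefficient is $\mathbb E(1-\kappa_i\mid\mathbf X)=\int_{1/n}^{\alpha_n}\mathbb E(1-\kappa_i\mid X_i,\tau)\,\pi(\tau\mid\mathbf X)\,d\tau$, where $\pi(\tau\mid\mathbf X)$ is the posterior density of $\tau$, i.e. $\pi(\tau\mid\mathbf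 X)\propto\pi_2(\tau)\prod_{i=1}^n m_\tau(X_i)$ with $m_\tau(x)=\int_0^\infty(2\pi(1+t\tau^2))^{-1/2}e^{-x^2/(2(1+t\tau^2))}\pi_1(t)\,dt$. Assumptions on $L$: (A1) there exist $c_0>0$ and $t_0>0$ such that $L(t)\ge c_0$ for all $t\ge t_0$; (A2) there exists $M\in(0,\infty)$ such that $\sup_{t\in(0,\infty)}L(t)\le M$. Beta-min class: for real $b$ (possibly depending on $n$), $\boldsymbol\Theta_b=\{\boldsymbol\theta\in\mathbb R^n:\ |S_{\boldsymbol\theta}|=q_n,\ |\theta_i|\ge\sqrt{2\log(n/q_n)}+b\ \text{for all } i\in S_{\boldsymbol\theta}\}$, where $S_{\boldsymbol\theta}=\{i:\theta_i\ne0\}$. Classification (Hamming) loss: $\mathcal L(\boldsymbol\theta,\boldsymbol\psi)=\sum_{i=1}^n\bigl[\mathbf 1\{\theta_i=0,\psi_i\ne0\}+\mathbf 1\{\theta_i\ne0,\psi_i=0\}\bigr]$. $\mathbb E_{\boldsymbol\theta}$ is expectation when the true mean vector is the fixed vector $\boldsymbol\theta$. $\Phi$ is the standard normal distribution function. For sequences, $a_n\asymp b_n$ means $0<c'\le a_n/b_n\le c''<\infty$ for some constants $c',c''$ and all sufficiently large $n$. *)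

(* Defs.v *)
From HB Require Import structures.
From mathcomp Require Import all_boot all_order all_algebra.
From mathcomp Require Import all_classical all_reals all_analysis.

Set Implicit Arguments.
Unset Strict Implicit.
Unset Printing Implicit Defensive.

Import Order.TTheory GRing.Theory Num.Theory.
Import numFieldNormedType.Exports.

Local Open Scope classical_set_scope.
Local Open Scope ring_scope.

Section Asymptotics.
Context {R : realType}.

Definition slowly_varying (L : R -> R) : Prop :=
  forall x : R, 0 < x -> L (x * t) / L t @[t --> +oo] --> (1 : R).

Definition same_order (u v : nat -> R) : Prop :=
  exists c' c'' : R, 0 < c' /\ \forall n \near \oo, c' <= u n / v n <= c''.

End Asymptotics.

Section NormalNoise.
Context {R : realType}.

Definition Phi (x : R) : R := fine (normal_prob (0 : R) 1 `]-oo, x]).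

Definition mutually_independent {d : measure_display} {T : measurableType d}
    {P : probability T R} {n : nat} (X : 'I_n -> {RV P >-> R}) : Prop :=
  forall (J : {set 'I_n}) (A : 'I_n -> set R), (forall i, measurable (A i)) ->
    P (\bigcap_(i in [set` J]) (X i @^-1` A i)) =
    (\prod_(i in J) P (X i @^-1` A i))%E.

Definition iid_standard_normal {d : measure_display} {T : measurableType d}
    {P : probability T R} {n : nat} (X : 'I_n -> {RV P >-> R}) : Prop :=
  mutually_independent X /\
  forall (i : 'I_n) (A : set R), measurable A ->
    distribution P (X i) A = normal_prob (0 : R) 1 A.

End NormalNoise.

Section OneGroupPrior.
Context {R : realType}.
Implicit Types (a K x tau : R) (L : R -> R).

Local Notation mu := (@lebesgue_measure R).

(* Densities live on (0, +oo); values on (-oo, 0] are irrelevant. *)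
Definition is_density (f : R -> R) : Prop :=
  [/\ measurable_fun (`]0, +oo[%classic : set R) f,
      forall t, 0 < t -> 0 <= f t &
      (\int[mu]_(t in `]0%R, +oo[) (f t)%:E = 1)%E].

(* Prior density of lambda_i ^ 2 (not of lambda_i). *)
Definition local_prior a K L (t : R) : R := K * t `^ (- a - 1) * L t.

(* E(1 - kappa_i | X_i = x, tau), where kappa_i = 1 / (1 + t * tau ^ 2) at
   lambda_i ^ 2 = t. The marginal law of X_i given (t, tau) is
   N(0, 1 + t * tau ^ 2); the factors K and (2 * pi) ^ (-1/2) cancel. *)
Definition shrinkage_mean a L tau x : R :=
  (\int[mu]_(t in `]0, +oo[)
     (t * tau ^+ 2 / (1 + t * tau ^+ 2) * (Num.sqrt (1 + t * tau ^+ 2))^-1 *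
      expR (- (x ^+ 2 / (2 * (1 + t * tau ^+ 2)))) * t `^ (- a - 1) * L t)) /
  (\int[mu]_(t in `]0, +oo[)
     ((Num.sqrt (1 + t * tau ^+ 2))^-1 *
      expR (- (x ^+ 2 / (2 * (1 + t * tau ^+ 2)))) * t `^ (- a - 1) * L t)).

(* m_tau(x): marginal density of X_i given tau. *)
Definition marginal_density a K L tau x : R :=
  \int[mu]_(t in `]0, +oo[)
     ((Num.sqrt (2 * pi * (1 + t * tau ^+ 2)))^-1 *
      expR (- (x ^+ 2 / (2 * (1 + t * tau ^+ 2)))) * local_prior a K L t).

Definition unnormalized_posterior a K L (pi2 : R -> R) {n : nat} (X : 'rV[R]_n) tau : R :=
  pi2 tau * \prod_(i < n) marginal_density a K L tau (X 0 i).

Definition posterior_density a K L (pi2 : R -> R) {n : nat} (X : 'rV[R]_n) tau : R :=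
  unnormalized_posterior a K L pi2 X tau /
  \int[mu]_(s in `]0, +oo[) unnormalized_posterior a K L pi2 X s.

(* E(1 - kappa_i | X), for a prior pi2 supported in [1/n, alpha]. *)
Definition full_bayes_coefficient a K L (pi2 : R -> R) (alpha : R) {n : nat}
    (X : 'rV[R]_n) (i : 'I_n) : R :=
  \int[mu]_(tau in `[n%:R^-1, alpha])
     (shrinkage_mean a L tau (X 0 i) * posterior_density a K L pi2 X tau).

Definition full_bayes_rule a K L (pi2 : R -> R) (alpha : R) {n : nat}
    (X : 'rV[R]_n) (i : 'I_n) : bool :=
  2^-1 < full_bayes_coefficient a K L pi2 alpha X i.

End OneGroupPrior.

Section MultipleTesting.
Context {R : realType}.

Definition signal_set {n : nat} (theta : 'rV[R]_n) : {set 'I_n} :=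
  [set i | theta 0 i != 0]%SET.

Definition beta_min_class {n : nat} (q : nat) (b : R) : set 'rV[R]_n :=
  [set theta | #|signal_set theta| = q /\
     forall i, i \in signal_set theta ->
       Num.sqrt (2 * ln (n%:R / q%:R)) + b <= `|theta 0 i| ].

Definition hamming_loss {n : nat} (theta : 'rV[R]_n) (psi : 'I_n -> bool) : nat :=
  (\sum_(i < n) (((theta 0%R i == 0%R) && psi i) +
                 ((theta 0%R i != 0%R) && ~~ psi i)))%N.

(* E_theta of the loss of the rule psi, when X_i = theta_i + eps_i. *)
Definition classification_risk {d : measure_display} {T : measurableType d}
    {P : probability T R} {n : nat} (eps : 'I_n -> {RV P >-> R})
    (psi : 'rV[R]_n -> 'I_n -> bool) (theta : 'rV[R]_n) : \bar R :=
  ('E_P[fun w : T =>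
     (hamming_loss theta (psi (\row_(i < n) (theta 0 i + eps i w))%R))%:R])%E.

Definition scaled_max_risk {d : measure_display} {T : measurableType d}
    {P : probability T R} {n : nat} (eps : 'I_n -> {RV P >-> R})
    (psi : 'rV[R]_n -> 'I_n -> bool) (q : nat) (b : R) : \bar R :=
  ((q%:R^-1)%:E *
   ereal_sup [set classification_risk eps psi theta |
              theta in beta_min_class q b])%E.

End MultipleTesting.

(* Main.v *)
(* Averaging over tau against the posterior density keeps the coefficient
   between the infimum and the supremum over tau in [1/n, alpha_n] of the
   fixed-tau shrinkage mean s(tau, x), so the rule is sandwiched between two
   deterministic thresholds on |X_i|, and only the one-dimensional marginals of
   the noise matter. On one side s(tau, x) <= C tau e^(x^2/2), so the rule
   cannot select below a threshold lo with
   lo^2 = 2 (log n - delta3 log log n) + O(1). On the other side, when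
   tau >= 1/n, s(tau, x) is close to 1 as soon as x^2 e^(-x^2/2) is small
   compared with 1/n, so the rule selects above hi with
   hi^2 = 2 log n + 4 log log n. Since log q_n = O(log log n), both thresholds
   are sqrt(2 log(n/q_n)) + o(1), which gives the misclassification probability
   1 - Phi(b) + o(1) of each signal. The expected number of false positives is
   at most 2 n Phi(-lo) = O((log n)^(delta3 - 1/2)), which vanishes because
   delta3 < 1/2. *)
Require Import Defs.
From HB Require Import structures.
From mathcomp Require Import all_boot all_order all_algebra.
From mathcomp Require Import all_classical all_reals all_analysis.
From mathcomp Require Import measurable_realfun.
From mathcomp Require Import ring lra.

Set Implicit Arguments.
Unset Strict Implicit.
Unset Printing Implicit Defensive.

Import Order.TTheory GRing.Theory Num.Theory.
Import numFieldNormedType.Exports.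

Local Open Scope classical_set_scope.
Local Open Scope ring_scope.

(** The likelihood of the whole sample enters only as a function of tau that is positive, bounded
    and measurable; nothing else about the posterior is used. The exponent a = 1/2 makes the bounds
    linear in tau: under u = t tau^2 the weight t^(-3/2) dt becomes tau u^(-3/2) du. The part of the
    mixing integral with large u is therefore of order tau, and it competes with a part of order
    e^(-x^2/2) coming from small u. At tau near 1/n the two balance around x^2 = 2 log n. The shift
    b enters the risk only through the argument of Phi, and Phi is Lipschitz, so the error has an
    explicit bound free of b. One squeeze then settles both a fixed b and a sequence tending to
    infinity. Real-valued integrals are the [fine] part of extended ones, which is 0 when the
    integral is infinite; hence the integrability facts that accompany every comparison. *)

(** * Measurability in a parameter, monotonicity and positivity of real integrals *)

Section ParametrizedIntegrals.
Context {R : realType}.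
Local Notation mu := (@lebesgue_measure R).

Lemma measurable_invr : measurable_fun setT (fun x : R => x^-1).
Proof.
(* A real power is an inverse only on nonnegative bases, hence the square; the factor x restores the
   sign and gives the default value 0 at x = 0. *)
have -> : (fun x : R => x^-1) = (fun x : R => x * (x ^+ 2) `^ (-1)).
  apply/funext => x; rewrite powR_inv1 ?sqr_ge0//.
  have [->|x0] := eqVneq x 0; first by rewrite invr0 mul0r.
  by rewrite expr2 invfM mulrA mulfV// mul1r.
apply: measurable_funM => //.
by apply: (@measurableT_comp _ _ _ _ _ _ (fun y : R => y `^ (-1))) => //;
  exact: measurable_funX.
Qed.

(** Tonelli applies without integrability because the integrand is nonnegative and [fine] is
    measurable. The factor [L] is kept apart from [h] because it is measurable only on the
    half-line, and is extended by 0 before passing to the plane. *)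
Lemma measurable_Rintegral_param (h : R -> R -> R) (L : R -> R) :
  measurable_fun setT (fun p : R * R => h p.1 p.2) ->
  measurable_fun (`]0, +oo[%classic : set R) L ->
  (forall tau t, 0 < t -> 0 <= h tau t) -> (forall t, 0 < t -> 0 <= L t) ->
  measurable_fun setT (fun tau => \int[mu]_(t in `]0, +oo[) (h tau t * L t)).
Proof.
move=> mh mL h0 L0.
have mL' : measurable_fun setT (L \_ `]0, +oo[).
  by apply/(measurable_restrictT L).
have := @measurable_fun_fubini_tonelli_F _ _ _ _ R mu
  (fun p : R * R => (h p.1 p.2 * (L \_ `]0, +oo[) p.2)%:E).
have mf : measurable_fun setT (fun p : R * R => (h p.1 p.2 * (L \_ `]0, +oo[) p.2)%:E).
  apply/measurable_EFinP; apply: measurable_funM => //.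
  exact: (measurableT_comp mL').
have f0 (p : R * R) : (0 <= (h p.1 p.2 * (L \_ `]0, +oo[) p.2)%:E)%E.
  rewrite lee_fin patchE; case: ifPn => [|_]; last by rewrite mulr0.
  by rewrite inE/= in_itv/= andbT => p0; rewrite mulr_ge0 ?h0 ?L0.
move=> /(_ mf f0) mF.
have -> : (fun tau => \int[mu]_(t in `]0, +oo[) (h tau t * L t)) =
    fine \o fubini_F mu (fun p : R * R => (h p.1 p.2 * (L \_ `]0, +oo[) p.2)%:E).
  apply/funext => tau /=; rewrite /Rintegral /fubini_F [in LHS]integral_mkcond.
  congr fine; apply: eq_integral => t _ /=; rewrite !patchE.
  by case: ifPn => // _; rewrite mulr0.
exact: measurableT_comp mF.
Qed.

Lemma Rintegral_ge0_le_subset (A B : set R) (f : R -> R) :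
  measurable A -> measurable B -> A `<=` B ->
  mu.-integrable B (EFin \o f) -> (forall x, B x -> 0 <= f x) ->
  \int[mu]_(x in A) f x <= \int[mu]_(x in B) f x.
Proof.
move=> mA mB AB fi f0; rewrite /Rintegral fine_le//.
- by apply: integrable_fin_num => //; exact: integrableS fi.
- exact: integrable_fin_num.
- apply: ge0_subset_integral => //; first exact: measurable_int fi.
Qed.

Lemma integrable_scale (D : set R) (k : R) (f : R -> R) : measurable D ->
  mu.-integrable D (EFin \o f) -> mu.-integrable D (EFin \o (fun t => k * f t)).
Proof.
move=> mD fi.
have kfi : mu.-integrable D (fun t => k%:E * (EFin \o f) t)%E by exact: integrableZl.
by apply: eq_integrable kfi => // t _ /=; rewrite EFinM.
Qed.

(** If the integral vanished, [f] would be 0 almost everywhere on [D]; as [f] is positive there, the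
    exceptional null set would contain [D]. *)
Lemma Rintegral_gt0 (D : set R) (f : R -> R) : measurable D ->
  mu.-integrable D (EFin \o f) -> (forall x, D x -> 0 < f x) ->
  (0 < mu D)%E -> 0 < \int[mu]_(x in D) f x.
Proof.
move=> mD fi f0 D0.
rewrite lt_neqAle Rintegral_ge0 ?andbT; last by move=> x /f0/ltW.
apply/eqP => /esym I0.
have E0 : (\int[mu]_(x in D) `|(EFin \o f) x| = 0)%E.
  transitivity (\int[mu]_(x in D) (EFin \o f) x)%E.
    by apply: eq_integral => x /[!inE] Dx /=; rewrite gtr0_norm ?f0.
  have I_fin : (\int[mu]_(x in D) (EFin \o f) x)%E \is a fin_num.
    exact: integrable_fin_num.
  by rewrite -(fineK I_fin); congr EFin.
have mf := measurable_int mu fi.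
have /(ae_eq_integral_abs mu mD mf) [N [mN N0 DN]] := E0.
suff : (mu D <= 0)%E by rewrite leNgt D0.
rewrite -N0; apply: le_measure; rewrite ?inE//.
move=> x Dx; apply: DN => /= /(_ Dx) [fx0].
by have := f0 _ Dx; rewrite fx0 ltxx.
Qed.

End ParametrizedIntegrals.

(** * The fixed-tau shrinkage mean as a ratio of integrals against the local prior *)

Section ShrinkageMean.
Context {R : realType}.
Local Notation mu := (@lebesgue_measure R).
Local Notation HA := (`]0, +oo[%classic : set R).

(** The local prior density at a = 1/2 without [K]; its total mass is 1 / K. *)
Definition mixing_weight (L : R -> R) (t : R) : R := t `^ (- 2^-1 - 1) * L t.

(** The N(0, 1 + t tau^2) density at x, up to the factor (2 pi)^(-1/2). *)
Definition marginal_kernel (x tau t : R) : R :=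
  (Num.sqrt (1 + t * tau ^+ 2))^-1 * expR (- (x ^+ 2 / (2 * (1 + t * tau ^+ 2)))).

Lemma powR_threehalves (t : R) : 0 < t -> t `^ (- 2^-1 - 1) = (t * Num.sqrt t)^-1.
Proof.
move=> t0; have -> : - 2^-1 - 1 = - (1 + 2^-1) :> R by rewrite opprD addrC.
rewrite powRN powRD; last by rewrite gt_eqF ?implybT.
by have /ltW t1 := t0; rewrite powRr1 ?powR12_sqrt.
Qed.

Lemma measurable_affine_square : measurable_fun setT (fun p : R * R => 1 + p.2 * p.1 ^+ 2).
Proof.
by apply: measurable_funD => //; apply: measurable_funM => //; exact: measurable_funX.
Qed.

Lemma measurable_invr_comp d (T : measurableType d) (D : set T) (f : T -> R) :
  measurable_fun D f -> measurable_fun D (fun x => (f x)^-1).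
Proof. exact: (measurableT_comp measurable_invr). Qed.

Lemma measurable_sqrt : measurable_fun setT (@Num.sqrt R).
Proof. by apply: continuous_measurable_fun; exact: sqrt_continuous. Qed.

Lemma measurable_marginal_kernel2 x :
  measurable_fun setT (fun p : R * R => marginal_kernel x p.1 p.2).
Proof.
apply: measurable_funM.
  apply: measurable_invr_comp; apply: (measurableT_comp measurable_sqrt).
  exact: measurable_affine_square.
apply: measurableT_comp => //; apply: measurableT_comp => //.
apply: measurable_funM => //; apply: measurable_invr_comp.
by apply: measurable_funM => //; exact: measurable_affine_square.
Qed.

Lemma measurable_marginal_kernel x tau : measurable_fun setT (marginal_kernel x tau).
Proof. exact: (measurableT_comp (measurable_marginal_kernel2 x) (pair1_measurable tau)). Qed.

Lemma one_le_affine_square (t tau : R) : 0 < t -> 1 <= 1 + t * tau ^+ 2.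
Proof. by move=> t0; rewrite lerDl mulr_ge0 ?sqr_ge0// ltW. Qed.

Lemma affine_square_gt0 (t tau : R) : 0 < t -> 0 < 1 + t * tau ^+ 2.
Proof. by move=> t0; rewrite (lt_le_trans ltr01)// one_le_affine_square. Qed.

Lemma marginal_kernel_gt0 x tau t : 0 < t -> 0 < marginal_kernel x tau t.
Proof.
by move=> t0; rewrite mulr_gt0 ?expR_gt0// invr_gt0 sqrtr_gt0 affine_square_gt0.
Qed.

Lemma sqrt_affine_square_ge1 (t tau : R) : 0 < t -> 1 <= Num.sqrt (1 + t * tau ^+ 2).
Proof.
by move=> t0; rewrite -[leLHS]sqrtr1 ler_wsqrtr// one_le_affine_square.
Qed.

(** The prefactor is at most 1, so only the exponent matters. It is used with e = 0, with e = (x^2 -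
    1) / 2 when t tau^2 is at most 1 / x^2, and with e = x^2 / 16 when t tau^2 is at most 7. *)
Lemma marginal_kernel_le x tau t e : 0 < t ->
  e <= x ^+ 2 / (2 * (1 + t * tau ^+ 2)) -> marginal_kernel x tau t <= expR (- e).
Proof.
move=> t0 he; rewrite /marginal_kernel -[leRHS]mul1r ler_pM ?invr_ge0 ?sqrtr_ge0 ?expR_ge0//.
  by rewrite invf_le1 ?sqrt_affine_square_ge1// sqrtr_gt0 affine_square_gt0.
by rewrite ler_expR lerN2.
Qed.

Lemma marginal_kernel_le1 x tau t : 0 < t -> marginal_kernel x tau t <= 1.
Proof.
move=> t0; rewrite -expR0 -oppr0; apply: marginal_kernel_le => //.
by rewrite mulr_ge0 ?sqr_ge0// invr_ge0 mulr_ge0// ltW// affine_square_gt0.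
Qed.

Lemma shrinkage_meanE (L : R -> R) tau x : shrinkage_mean 2^-1 L tau x =
  (\int[mu]_(t in HA) (t * tau ^+ 2 / (1 + t * tau ^+ 2) *
     (marginal_kernel x tau t * mixing_weight L t))) /
  (\int[mu]_(t in HA) (marginal_kernel x tau t * mixing_weight L t)).
Proof.
rewrite /shrinkage_mean /marginal_kernel /mixing_weight; congr (_ / _);
  by apply: eq_Rintegral => t _; rewrite !mulrA.
Qed.

Context (L : R -> R) (K : R) (hL_pos : forall t, 0 < t -> 0 < L t)
  (hL_meas : measurable_fun HA L) (hK : 0 < K)
  (hpi1 : is_density (local_prior 2^-1 K L)).

Local Notation w := (mixing_weight L).

Lemma mixing_weight_gt0 t : 0 < t -> 0 < w t.
Proof. by move=> t0; rewrite mulr_gt0 ?powR_gt0 ?hL_pos. Qed.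

Lemma measurable_mixing_weight : measurable_fun HA w.
Proof.
apply: measurable_funM => //; apply: measurable_funTS; exact: measurable_powR.
Qed.

Lemma local_priorE t : local_prior 2^-1 K L t = K * w t.
Proof. by rewrite /local_prior -mulrA. Qed.

Lemma integral_mixing_weight : (\int[mu]_(t in HA) (w t)%:E = (K^-1)%:E)%E.
Proof.
case: hpi1 => _ _ h1.
transitivity (\int[mu]_(t in HA) (K^-1%:E * (local_prior 2^-1 K L t)%:E))%E.
  apply: eq_integral => t _; rewrite local_priorE -EFinM mulrA mulVf ?mul1r//.
  by rewrite gt_eqF.
rewrite ge0_integralZl//; first by rewrite h1 mule1.
- by apply/measurable_EFinP; case: hpi1.
- by move=> t /=; rewrite in_itv/= andbT => t0; rewrite lee_fin; case: hpi1 => _ + _; apply.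
- by rewrite lee_fin invr_ge0 ltW.
Qed.

Lemma integrable_mixing_weight : mu.-integrable HA (EFin \o w).
Proof.
apply/integrableP; split; first by apply/measurable_EFinP; exact: measurable_mixing_weight.
rewrite (_ : integral _ _ _ = (K^-1)%:E) ?ltry// -integral_mixing_weight.
apply: eq_integral => t /[!inE]/=; rewrite in_itv/= andbT => t0.
by rewrite gtr0_norm// mixing_weight_gt0.
Qed.

(** Numerator and denominator of the shrinkage mean both have this shape, so domination by the
    weight gives their integrability at once. *)
Lemma integrable_bounded_mixing (h : R -> R) : measurable_fun HA h ->
  (forall t, 0 < t -> 0 <= h t <= 1) ->
  mu.-integrable HA (EFin \o (fun t => h t * w t)).
Proof.
move=> mh h01.
have le_w (t : R) : 0 < t -> `|h t * w t| <= `|w t|.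
  move=> t0; have /andP[h0 h1] := h01 _ t0; have /ltW w0 := mixing_weight_gt0 t0.
  by rewrite (ger0_norm w0) (ger0_norm (mulr_ge0 h0 w0)) ler_piMl.
apply: (le_integrable _ _ _ integrable_mixing_weight) => //.
  by apply/measurable_EFinP; apply: measurable_funM => //; exact: measurable_mixing_weight.
by move=> t /=; rewrite in_itv/= andbT lee_fin; exact: le_w.
Qed.

Lemma integrable_kernel_mixing x tau :
  mu.-integrable HA (EFin \o (fun t => marginal_kernel x tau t * w t)).
Proof.
apply: integrable_bounded_mixing => [|t t0].
  by apply: measurable_funTS; exact: measurable_marginal_kernel.
by rewrite (ltW (marginal_kernel_gt0 _ _ _))//= marginal_kernel_le1.
Qed.

Lemma shrink_weight_bounds (t tau : R) : 0 < t ->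
  0 <= t * tau ^+ 2 / (1 + t * tau ^+ 2) <= 1.
Proof.
move=> t0; have := one_le_affine_square tau t0 => h.
have a0 := affine_square_gt0 tau t0.
have s0 : 0 <= t * tau ^+ 2 by rewrite mulr_ge0 ?sqr_ge0// ltW.
by rewrite divr_ge0 ?(ltW a0)//= ler_pdivrMr// mul1r lerDr.
Qed.

Lemma measurable_shrink_weight2 :
  measurable_fun setT (fun p : R * R => p.2 * p.1 ^+ 2 / (1 + p.2 * p.1 ^+ 2)).
Proof.
apply: measurable_funM.
  by apply: measurable_funM => //; exact: measurable_funX.
by apply: measurable_invr_comp; exact: measurable_affine_square.
Qed.

Lemma integrable_shrink_kernel_mixing x tau :
  mu.-integrable HA (EFin \o (fun t => t * tau ^+ 2 / (1 + t * tau ^+ 2) *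
    (marginal_kernel x tau t * w t))).
Proof.
under [X in EFin \o X]eq_fun do rewrite mulrA.
apply: integrable_bounded_mixing => [|t t0].
  apply: measurable_funTS; apply: measurable_funM; last exact: measurable_marginal_kernel.
  exact: (measurableT_comp measurable_shrink_weight2 (pair1_measurable tau)).
have /andP[a b] := shrink_weight_bounds tau t0.
have /ltW c := marginal_kernel_gt0 x tau t0.
by rewrite mulr_ge0//= mulr_ile1// marginal_kernel_le1.
Qed.

Lemma kernel_integral_gt0 x tau :
  0 < \int[mu]_(t in HA) (marginal_kernel x tau t * w t).
Proof.
apply: Rintegral_gt0 => //; first exact: integrable_kernel_mixing.
  move=> t /=; rewrite in_itv/= andbT => t0.
  by rewrite mulr_gt0 ?marginal_kernel_gt0 ?mixing_weight_gt0.
by rewrite lebesgue_measure_itv/= ltry/= oppr0 adde0 ltry.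
Qed.

Lemma measurable_kernel_integral x : measurable_fun setT (fun tau : R =>
  \int[mu]_(t in HA) (marginal_kernel x tau t * w t)).
Proof.
have mp : measurable_fun setT (fun p : R * R => p.2 `^ (- 2^-1 - 1)).
  exact: (measurableT_comp (measurable_powR _)).
have L0 t : 0 < t -> 0 <= L t by move=> t0; exact/ltW/hL_pos.
have h0 (tau t : R) : 0 < t -> 0 <= marginal_kernel x tau t * t `^ (- 2^-1 - 1).
  by move=> t0; rewrite mulr_ge0 ?powR_ge0// ltW// marginal_kernel_gt0.
have := measurable_Rintegral_param
  (measurable_funM (measurable_marginal_kernel2 x) mp) hL_meas h0 L0.
congr (measurable_fun _ _); apply/funext => tau; apply: eq_Rintegral => t _ /=.
by rewrite -mulrA.
Qed.

Lemma measurable_shrinkage_mean x :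
  measurable_fun setT (fun tau => shrinkage_mean 2^-1 L tau x).
Proof.
under eq_fun do rewrite shrinkage_meanE.
apply: measurable_funM; last by apply: measurable_invr_comp; exact: measurable_kernel_integral.
have mp : measurable_fun setT (fun p : R * R => p.2 `^ (- 2^-1 - 1)).
  exact: (measurableT_comp (measurable_powR _)).
have L0 t : 0 < t -> 0 <= L t by move=> t0; exact/ltW/hL_pos.
have h0 (tau t : R) : 0 < t -> 0 <= t * tau ^+ 2 / (1 + t * tau ^+ 2) *
    (marginal_kernel x tau t * t `^ (- 2^-1 - 1)).
  move=> t0; have /andP[s0 _] := shrink_weight_bounds tau t0.
  by rewrite (mulr_ge0 s0)// mulr_ge0 ?powR_ge0// ltW// marginal_kernel_gt0.
have := measurable_Rintegral_param (measurable_funM measurable_shrink_weight2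
  (measurable_funM (measurable_marginal_kernel2 x) mp)) hL_meas h0 L0.
congr (measurable_fun _ _); apply/funext => tau; apply: eq_Rintegral => t _ /=.
by rewrite /mixing_weight !mulrA.
Qed.

End ShrinkageMean.

(** * An elementary integral dominating the tail of the numerator *)

Section TailIntegral.
Context {R : realType}.
Local Notation mu := (@lebesgue_measure R).

Lemma cvgy_sqrt : Num.sqrt x @[x --> +oo] --> (+oo : set_system R).
Proof.
apply/cvgryPge => A; near=> t.
by rewrite (le_trans (ler_norm A))// -sqrtr_sqr ler_wsqrtr//; near: t; exact: nbhs_pinfty_ge.
Unshelve. all: by end_near. Qed.

(** With r = sqrt t the integrand becomes 4 tau^2 / (1 + tau r)^2 dr, whose primitive is -4 tau / (1
    + tau r). Using (1 + tau r)^2 in place of 1 + tau^2 t avoids an arctangent. *)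
Lemma integral_tail_bound (tau : R) : 0 < tau ->
  (\int[mu]_(t in `[1%R, +oo[)
     (2 * tau ^+ 2 / (Num.sqrt t * (1 + tau * Num.sqrt t) ^+ 2))%:E <=
   (4 * tau)%:E)%E.
Proof.
move=> tau0.
pose g (t : R) := 1 + tau * Num.sqrt t.
pose F (t : R) := - (4 * tau) * (g t)^-1.
have p0 (t : R) : 0 < g t.
  by rewrite ltr_pwDl// mulr_ge0 ?sqrtr_ge0// ltW.
have dF (t : R) : 0 < t ->
    is_derive t 1 F (2 * tau ^+ 2 / (Num.sqrt t * g t ^+ 2)).
  move=> t0; have n0 : g t != 0 by rewrite gt_eqF.
  have dg : is_derive t 1 g (0 + tau *: (2 * Num.sqrt t)^-1).
    exact: (is_deriveD (is_derive_cst (1 : R) t 1)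
      (is_deriveZ tau (is_derive1_sqrt t0))).
  have := is_deriveZ (- (4 * tau)) (is_deriveV n0 dg).
  congr (is_derive _ _ _ _); rewrite add0r /GRing.scale /=.
  have s0 : Num.sqrt t != 0 by rewrite gt_eqF// sqrtr_gt0.
  by field; rewrite n0 s0.
have cg : continuous g.
  move=> t; apply: cvgD; first exact: cvg_cst.
  by apply: cvgM; [exact: cvg_cst|exact: sqrt_continuous].
rewrite (@ge0_continuous_FTC2y _ _ F 1 0).
- rewrite -EFinB lee_fin /F sub0r mulNr opprK ler_pdivrMr ?p0//.
  have t0 := ltW tau0; rewrite ler_peMr ?(mulr_ge0 _ t0)// /g lerDl.
  by rewrite mulr_ge0 ?sqrtr_ge0.
- by move=> t _; apply: divr_ge0; rewrite mulr_ge0 ?sqrtr_ge0 ?sqr_ge0.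
- apply: continuous_in_subspaceT => t; rewrite inE/= in_itv/= andbT => t1.
  have s0 : Num.sqrt t * g t ^+ 2 != 0.
    by rewrite gt_eqF// mulr_gt0 ?exprn_gt0 ?p0// sqrtr_gt0 (lt_le_trans ltr01).
  apply: cvgM; first exact: cvg_cst.
  apply: cvgV => //; apply: cvgM; first exact: sqrt_continuous.
  by apply: cvgM; exact: cg.
- rewrite -(mulr0 (- (4 * tau))); apply: cvgM; first exact: cvg_cst.
  apply/gtr0_cvgV0; first exact: nearW.
  apply/cvgryPge => A; near=> t.
  rewrite (@le_trans _ _ (tau * Num.sqrt t)) ?lerDr ?ler01// mulrC -ler_pdivrMr//.
  by near: t; move/cvgryPge : cvgy_sqrt; exact.
- by move=> t t1; have [] := dF t (lt_trans ltr01 t1).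
- apply: cvg_at_right_filter; apply: cvgM; first exact: cvg_cst.
  by apply: cvgV; [rewrite gt_eqF|exact: cg].
- move=> t; rewrite in_itv/= andbT => t1.
  rewrite derive1E; apply/(@derive_val _ _ _ _ _ _ _ (dF t (lt_trans ltr01 t1))).
Unshelve. all: by end_near. Qed.
End TailIntegral.

(** * Upper bound on the shrinkage mean *)

Section ShrinkageBounds.
Context {R : realType}.
Local Notation mu := (@lebesgue_measure R).
Local Notation HA := (`]0, +oo[%classic : set R).

Lemma Rintegral_le_ge0 (D : set R) (f g : R -> R) (c : R) : measurable D ->
  mu.-integrable D (EFin \o f) -> measurable_fun D g ->
  (forall t, D t -> 0 <= f t <= g t) -> (\int[mu]_(t in D) (g t)%:E <= c%:E)%E ->
  \int[mu]_(t in D) f t <= c.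
Proof.
move=> mD fi mg fg gc; rewrite -lee_fin /Rintegral fineK; last exact: integrable_fin_num.
apply: le_trans gc; apply: ge0_le_integral => //.
- by move=> t /fg /andP[]; rewrite lee_fin.
- exact: measurable_int fi.
- exact/measurable_EFinP.
- by move=> t /fg /andP[]; rewrite lee_fin.
Qed.

Context (L : R -> R) (K : R) (hL_pos : forall t, 0 < t -> 0 < L t)
  (hL_meas : measurable_fun HA L) (hK : 0 < K)
  (hpi1 : is_density (local_prior 2^-1 K L)).
Context (M : R) (hM : forall t, 0 < t -> L t <= M).

Local Notation w := (mixing_weight L).

Lemma M_gt0 : 0 < M.
Proof. exact: lt_le_trans (hL_pos ltr01) (hM ltr01). Qed.

Lemma Rintegral_mixing_weight : \int[mu]_(t in HA) w t = K^-1.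
Proof. by rewrite /Rintegral (integral_mixing_weight hK hpi1). Qed.

Lemma measurable_tail_integrand (tau : R) (D : set R) : measurable_fun D
  (fun t => 2 * tau ^+ 2 / (Num.sqrt t * (1 + tau * Num.sqrt t) ^+ 2)).
Proof.
apply: measurable_funTS; apply: measurable_funM => //; apply: measurable_invr_comp.
have ms := @measurable_sqrt R.
apply: measurable_funM => //; apply: measurable_funX; apply: measurable_funD => //.
exact: measurable_funM.
Qed.

(** Bound the kernel by 1 and [L] by [M]; with r = sqrt t and s = tau r what remains is M tau^2 / (r
    (1 + s^2)). *)
Lemma shrink_tail_pointwise x (tau t : R) : 0 < tau -> 0 < t ->
  t * tau ^+ 2 / (1 + t * tau ^+ 2) * (marginal_kernel x tau t * w t) <=
  M * (2 * tau ^+ 2 / (Num.sqrt t * (1 + tau * Num.sqrt t) ^+ 2)).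
Proof.
move=> tau0 t0; have r0 : 0 < Num.sqrt t by rewrite sqrtr_gt0.
have tr : t = Num.sqrt t ^+ 2 by rewrite sqr_sqrtr// ltW.
have k1 := marginal_kernel_le1 x tau t0; have /ltW k0 := marginal_kernel_gt0 x tau t0.
have a0 := affine_square_gt0 tau t0.
have wM : w t <= M * (t * Num.sqrt t)^-1.
  rewrite /mixing_weight powR_threehalves// mulrC ler_wpM2r ?hM//.
  by rewrite invr_ge0 mulr_ge0// ltW.
have w0 := ltW (mixing_weight_gt0 hL_pos t0).
have /andP[s0 _] := shrink_weight_bounds tau t0.
apply: (@le_trans _ _ (t * tau ^+ 2 / (1 + t * tau ^+ 2) * (M * (t * Num.sqrt t)^-1))).
  by rewrite ler_wpM2l// (le_trans _ wM)// ler_piMl.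
move: a0; rewrite {}tr; set r := Num.sqrt t in r0 *.
have -> : Num.sqrt (r ^+ 2) = r by rewrite sqrtr_sqr gtr0_norm.
move=> a0; set s := tau * r.
have s1 : 0 < 1 + s by rewrite ltr_pwDl// mulr_ge0// ltW.
have as_ : 1 + r ^+ 2 * tau ^+ 2 = 1 + s ^+ 2 by rewrite /s; ring.
rewrite as_ in a0 *.
have -> : r ^+ 2 * tau ^+ 2 / (1 + s ^+ 2) * (M / (r ^+ 2 * r)) =
  M * tau ^+ 2 / r * (1 + s ^+ 2)^-1.
  by field; rewrite !gt_eqF.
have -> : M * (2 * tau ^+ 2 / (r * (1 + s) ^+ 2)) =
  M * tau ^+ 2 / r * (2 / (1 + s) ^+ 2).
  by field; rewrite !gt_eqF.
rewrite ler_wpM2l//.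
  by rewrite divr_ge0 ?(ltW r0)// mulr_ge0 ?sqr_ge0// ltW// M_gt0.
rewrite -div1r ler_pdivrMr// mulrAC ler_pdivlMr ?exprn_gt0// mul1r.
(* This square is the difference in (1 + s)^2 <= 2 (1 + s^2), which is where the factor 2 in the
   majorant comes from. *)
have := sqr_ge0 (1 - s); nra.
Qed.

(** Split at t = 1. Below, the shrinkage weight is at most tau^2 <= tau and the mixing weight has
    mass 1 / K; above, the boundedness of [L] and the explicit tail integral give 4 M tau. *)
Lemma shrink_numerator_le x tau : 0 < tau <= 1 ->
  \int[mu]_(t in HA) (t * tau ^+ 2 / (1 + t * tau ^+ 2) *
     (marginal_kernel x tau t * w t)) <= (K^-1 + 4 * M) * tau.
Proof.
move=> /andP[tau0 tau1].
have M0 := M_gt0.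
have fi := integrable_shrink_kernel_mixing hL_pos hL_meas hK hpi1 x tau.
have f0 (t : R) : 0 < t -> 0 <= t * tau ^+ 2 / (1 + t * tau ^+ 2) *
     (marginal_kernel x tau t * w t).
  move=> t0; have /andP[s0 _] := shrink_weight_bounds tau t0.
  by rewrite (mulr_ge0 s0)// mulr_ge0// ltW ?marginal_kernel_gt0 ?mixing_weight_gt0.
have f1 (t : R) : 0 < t -> t < 1 -> t * tau ^+ 2 / (1 + t * tau ^+ 2) *
     (marginal_kernel x tau t * w t) <= tau * w t.
  move=> t0 t1; rewrite mulrA ler_wpM2r ?(ltW (mixing_weight_gt0 hL_pos t0))//.
  have /andP[s0 _] := shrink_weight_bounds tau t0.
  rewrite (le_trans (ler_piMr s0 (marginal_kernel_le1 _ _ t0)))//.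
  rewrite ler_pdivrMr ?affine_square_gt0//.
  have : t * tau ^+ 2 <= 1 * tau ^+ 2 by rewrite ler_wpM2r ?sqr_ge0 ?(ltW t1).
  have : tau ^+ 2 <= tau by rewrite expr2 ler_piMr// ltW.
  have : 0 <= tau * (t * tau ^+ 2) by rewrite !mulr_ge0 ?sqr_ge0 ?ltW.
  by move=> ? ? ?; rewrite mulrDr mulr1; lra.
have HAE : HA = `]0, 1[%classic `|` `[1, +oo[%classic.
  by rewrite -itv_bndbnd_setU// bnd_simp.
rewrite {1}HAE Rintegral_setU//; last 2 first.
- by rewrite -HAE.
- apply/disj_set2P; rewrite -subset0 => t [] /=; rewrite !in_itv/= andbT => /andP[_ t1].
  by rewrite leNgt t1.
rewrite mulrDl; apply: lerD.
- apply: (@Rintegral_le_ge0 _ _ (fun t => tau * w t)) => //.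
  + by apply: integrableS fi => //; rewrite HAE; exact: subsetUl.
  + apply: measurable_funM => //; apply: measurable_funS (measurable_mixing_weight hL_meas) => //.
    by rewrite HAE; exact: subsetUl.
  + by move=> t /=; rewrite in_itv/= => /andP[t0 t1]; rewrite f0// f1.
  + have mtw : measurable_fun HA (EFin \o (fun t => tau * w t)).
      apply/measurable_EFinP; apply: measurable_funM => //.
      exact: measurable_mixing_weight.
    have tw0 (t : R) : HA t -> (0 <= (tau * w t)%:E)%E.
      rewrite /= in_itv/= andbT => t0; rewrite lee_fin mulr_ge0 ?(ltW tau0)//.
      exact/ltW/mixing_weight_gt0.
    apply: (@le_trans _ _ (\int[mu]_(t in HA) (tau * w t)%:E)%E).
      by apply: ge0_subset_integral => //; rewrite HAE; exact: subsetUl.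
    under eq_integral do rewrite EFinM.
    rewrite ge0_integralZl_EFin//.
    * by rewrite (integral_mixing_weight hK hpi1) -EFinM mulrC.
    * by move=> t /=; rewrite in_itv/= andbT => t0; rewrite lee_fin ltW// mixing_weight_gt0.
    * by apply/measurable_EFinP; exact: measurable_mixing_weight.
    * exact: ltW.
- apply: (@Rintegral_le_ge0 _ _
    (fun t => M * (2 * tau ^+ 2 / (Num.sqrt t * (1 + tau * Num.sqrt t) ^+ 2)))) => //.
  + by apply: integrableS fi => //; rewrite HAE; exact: subsetUr.
  + apply: measurable_funM => //; exact: measurable_tail_integrand.
  + move=> t /=; rewrite in_itv/= andbT => t1; have t0 := lt_le_trans ltr01 t1.
    by rewrite f0// shrink_tail_pointwise.
  + under eq_integral do rewrite EFinM.
    rewrite ge0_integralZl_EFin//; last 3 first.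
    * move=> t _; rewrite lee_fin; apply: divr_ge0; first by rewrite mulr_ge0 ?sqr_ge0.
      by rewrite mulr_ge0 ?sqrtr_ge0 ?sqr_ge0.
    * by apply/measurable_EFinP; exact: measurable_tail_integrand.
    * exact: ltW.
    have -> : 4 * M * tau = M * (4 * tau) by ring.
    by rewrite [leRHS]EFinM lee_wpmul2l ?lee_fin ?(ltW M0)// integral_tail_bound.
Qed.

(** For tau <= 1 the kernel is at least (1 + t)^(-1/2) e^(-x^2/2), so the denominator is at least
    e^(-x^2/2) times a constant [c1] that involves neither tau nor x. *)
Lemma shrinkage_mean_le : exists2 C : R, 0 < C & forall x tau, 0 < tau <= 1 ->
  shrinkage_mean 2^-1 L tau x <= C * tau * expR (x ^+ 2 / 2).
Proof.
have M0 := M_gt0.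
set c1 : R := \int[mu]_(t in HA) ((Num.sqrt (1 + t))^-1 * w t).
have m1 : measurable_fun HA (fun t : R => (Num.sqrt (1 + t))^-1).
  apply: measurable_funTS; apply: measurable_invr_comp.
  by apply: (measurableT_comp measurable_sqrt); exact: measurable_funD.
have b1 (t : R) : 0 < t -> 0 < (Num.sqrt (1 + t))^-1 <= 1.
  move=> t0; have s1 : 1 <= Num.sqrt (1 + t).
    by rewrite -[leLHS]sqrtr1 ler_wsqrtr// lerDl ltW.
  by rewrite invr_gt0 (lt_le_trans ltr01 s1)/= invf_le1// (lt_le_trans ltr01 s1).
have i1 : mu.-integrable HA (EFin \o (fun t => (Num.sqrt (1 + t))^-1 * w t)).
  apply: (integrable_bounded_mixing hL_pos hL_meas hK hpi1) => // t /b1 /andP[/ltW -> ->] //.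
have c10 : 0 < c1.
  apply: Rintegral_gt0 => //.
    move=> t /=; rewrite in_itv/= andbT => t0; have /andP[? _] := b1 _ t0.
    by rewrite mulr_gt0// mixing_weight_gt0.
  by rewrite lebesgue_measure_itv/= ltry/= oppr0 adde0 ltry.
exists ((K^-1 + 4 * M) / c1); first by rewrite divr_gt0// addr_gt0 ?invr_gt0// mulr_gt0.
move=> x tau tau01; have /andP[tau0 tau1] := tau01.
rewrite shrinkage_meanE.
have D0 := kernel_integral_gt0 hL_pos hL_meas hK hpi1 x tau.
rewrite ler_pdivrMr//; apply: (le_trans (shrink_numerator_le x tau01)).
have D1 : expR (- (x ^+ 2 / 2)) * c1 <=
    \int[mu]_(t in HA) (marginal_kernel x tau t * w t).
  rewrite /c1 -RintegralZl//; apply: le_Rintegral => //.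
  - exact: integrable_scale.
  - exact: (integrable_kernel_mixing hL_pos hL_meas hK hpi1).
  move=> t /=; rewrite in_itv/= andbT => t0.
  rewrite mulrA ler_wpM2r ?(ltW (mixing_weight_gt0 hL_pos t0))// mulrC.
  have a1 := one_le_affine_square tau t0.
  rewrite /marginal_kernel ler_pM ?expR_ge0 ?invr_ge0 ?sqrtr_ge0//.
    rewrite lef_pV2 ?posrE ?sqrtr_gt0 ?affine_square_gt0 ?addr_gt0//.
    by rewrite ler_wsqrtr// lerD2l ler_piMr ?(ltW t0)// expr_le1// ltW.
  rewrite ler_expR lerN2 invfM mulrA ler_piMr ?divr_ge0 ?sqr_ge0//.
  by rewrite invf_le1// affine_square_gt0.
apply: le_trans (ler_wpM2l _ D1); last first.
  by rewrite !mulr_ge0 ?expR_ge0 ?invr_ge0 ?addr_ge0 ?mulr_ge0 ?(ltW c10) ?(ltW tau0) ?(ltW M0) ?invr_ge0 ?(ltW hK).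
rewrite expRN [leRHS](_ : _ = (K^-1 + 4 * M) * tau)//.
by field; rewrite !gt_eqF ?expR_gt0.
Qed.

End ShrinkageBounds.

(** * Lower bound on the shrinkage mean for large observations *)

Section ShrinkageLowerBound.
Context {R : realType}.
Local Notation mu := (@lebesgue_measure R).
Local Notation HA := (`]0, +oo[%classic : set R).

Lemma integrable_cst_itv (a b k : R) (p q : bool) :
  mu.-integrable [set` Interval (BSide p a) (BSide q b)] (EFin \o (fun=> k)).
Proof.
apply/integrableP; split; first by apply/measurable_EFinP.
under eq_integral do rewrite /=.
rewrite integral_cst//= lebesgue_measure_itv/=; case: ifPn => _.
  by rewrite -EFinB -EFinM ltry.
by rewrite mule0 ltry.
Qed.

Lemma Rintegral_cst_itv (a b k : R) (p q : bool) : a <= b ->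
  \int[mu]_(t in [set` Interval (BSide p a) (BSide q b)]) k = k * (b - a).
Proof.
move=> ab; rewrite /Rintegral integral_cst//= lebesgue_measure_itv/= lte_fin.
by case: ltgtP ab => //= -> _; rewrite subrr.
Qed.

Lemma Rintegral_itv_ge (f : R -> R) (a b k : R) (p q : bool) : a <= b ->
  mu.-integrable [set` Interval (BSide p a) (BSide q b)] (EFin \o f) ->
  (forall t, t \in Interval (BSide p a) (BSide q b) -> k <= f t) ->
  k * (b - a) <= \int[mu]_(t in [set` Interval (BSide p a) (BSide q b)]) f t.
Proof.
move=> ab fi kf; rewrite -(@Rintegral_cst_itv a b k p q ab).
apply: le_Rintegral => //; exact: integrable_cst_itv.
Qed.

Lemma Rintegral_itv_le (f : R -> R) (a b k : R) (p q : bool) : a <= b ->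
  mu.-integrable [set` Interval (BSide p a) (BSide q b)] (EFin \o f) ->
  (forall t, t \in Interval (BSide p a) (BSide q b) -> f t <= k) ->
  \int[mu]_(t in [set` Interval (BSide p a) (BSide q b)]) f t <= k * (b - a).
Proof.
move=> ab fi kf; rewrite -(@Rintegral_cst_itv a b k p q ab).
apply: le_Rintegral => //; exact: integrable_cst_itv.
Qed.

(** [p] is true for a closed left end, so the second condition only forbids an interval that
    contains 0. *)
Lemma subset_itv_pos (a : R) (p : bool) (b : itv_bound R) : 0 <= a -> (a == 0) ==> ~~ p ->
  [set` Interval (BSide p a) b] `<=` HA.
Proof.
move=> a0 ap t /=; rewrite !itv_boundlr/= andbT => /andP[h _].
case: p ap h => /=; rewrite bnd_simp ?implybF ?implybT => ap h.
  by rewrite bnd_simp (lt_le_trans _ h)// lt_def ap.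
by rewrite bnd_simp (le_lt_trans a0).
Qed.

Context (L : R -> R) (K : R) (hL_pos : forall t, 0 < t -> 0 < L t)
  (hL_meas : measurable_fun HA L) (hK : 0 < K)
  (hpi1 : is_density (local_prior 2^-1 K L)).
Context (M : R) (hM : forall t, 0 < t -> L t <= M).
Context (c0 t0 : R) (hc0 : 0 < c0) (ht0 : 0 < t0) (hA1 : forall t, t0 <= t -> c0 <= L t).

Local Notation w := (mixing_weight L).

(** Where u = t tau^2 lies between x^2 and 2 x^2 the exponential is at least e^(-1/2), and t >= x^2
    >= t0 makes the lower bound on [L] available. *)
Lemma kernel_mixing_ge x (tau t : R) : 0 < tau <= 1 -> 1 <= x ^+ 2 -> t0 <= x ^+ 2 ->
  x ^+ 2 / tau ^+ 2 <= t <= 2 * x ^+ 2 / tau ^+ 2 ->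
  c0 * expR (- 2^-1) * tau ^+ 3 / (5 * (x ^+ 2) ^+ 2) <= marginal_kernel x tau t * w t.
Proof.
move=> /andP[tau0 tau1]; set y := x ^+ 2 => y1 yt0 /andP[ht1 ht2].
have y0 : 0 < y by exact: lt_le_trans y1.
have tau20 : 0 < tau ^+ 2 by rewrite exprn_gt0.
have yt : y <= t * tau ^+ 2 by rewrite -ler_pdivrMr.
have ty : t * tau ^+ 2 <= 2 * y by rewrite -ler_pdivlMr.
have t_pos : 0 < t by rewrite (lt_le_trans _ ht1)// divr_gt0.
have Lt : c0 <= L t.
  apply: hA1; rewrite (le_trans yt0)// (le_trans _ ht1)// ler_pdivlMr//.
  by rewrite ler_piMr ?(ltW y0)// expr_le1// ltW.
have s0 : 0 < Num.sqrt (1 + t * tau ^+ 2) by rewrite sqrtr_gt0 affine_square_gt0.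
have r0 : 0 < Num.sqrt t by rewrite sqrtr_gt0.
rewrite /mixing_weight powR_threehalves// /marginal_kernel -/y.
have e1 : expR (- 2^-1) <= expR (- (y / (2 * (1 + t * tau ^+ 2)))).
  rewrite ler_expR lerN2 ler_pdivrMr ?mulr_gt0 ?affine_square_gt0//.
  by rewrite mulrA mulVf ?mul1r// -[leLHS]add0r lerD.
have den : Num.sqrt (1 + t * tau ^+ 2) * (t * Num.sqrt t) <= 5 * y ^+ 2 / tau ^+ 3.
  (* From 1 + u <= 3 y and t <= 2 y / tau^2 the product under the root is at most 6 y^2 / tau^2, and
     5/2 is a rational bound for sqrt 6. *)
  have h1 : Num.sqrt (1 + t * tau ^+ 2) * Num.sqrt t <= 5 / 2 * y / tau.
    rewrite -sqrtrM ?(ltW (affine_square_gt0 _ _))//.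
    rewrite -[leRHS]ger0_norm; last by rewrite divr_ge0 ?(ltW tau0)// mulr_ge0// ltW.
    rewrite -sqrtr_sqr ler_wsqrtr//.
    have -> : (5 / 2 * y / tau) ^+ 2 = 25 / 4 * y ^+ 2 / tau ^+ 2.
      by field; rewrite gt_eqF.
    rewrite ler_pdivlMr// -(mulrA (1 + _)).
    have s1 := affine_square_gt0 tau t_pos.
    apply: (@le_trans _ _ ((3 * y) * (2 * y))).
      by apply: ler_pM => //; [exact: ltW|rewrite mulr_ge0// ltW|lra].
    have := sqr_ge0 y; rewrite expr2; lra.
  rewrite mulrCA mulrC.
  have -> : 5 * y ^+ 2 / tau ^+ 3 = (5 / 2 * y / tau) * (2 * y / tau ^+ 2).
    by field; rewrite gt_eqF.
  by rewrite ler_pM// ?mulr_ge0 ?(ltW s0) ?(ltW r0) ?(ltW t_pos).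
rewrite -[leLHS]mulrA -invf_div.
have -> : (Num.sqrt (1 + t * tau ^+ 2))^-1 * expR (- (y / (2 * (1 + t * tau ^+ 2)))) *
   ((t * Num.sqrt t)^-1 * L t) =
  L t * expR (- (y / (2 * (1 + t * tau ^+ 2)))) *
    (Num.sqrt (1 + t * tau ^+ 2) * (t * Num.sqrt t))^-1.
  by field; rewrite !gt_eqF.
have den0 : 0 < Num.sqrt (1 + t * tau ^+ 2) * (t * Num.sqrt t) by rewrite !mulr_gt0.
apply: ler_pM.
- by rewrite mulr_ge0 ?expR_ge0// ltW.
- by rewrite invr_ge0 (le_trans (ltW den0) den).
- by rewrite ler_pM ?expR_ge0// ltW.
- by rewrite lef_pV2 ?posrE// (lt_le_trans den0 den).
Qed.

(** The pointwise bound of order tau^3 / x^4 holds on an interval of length x^2 / tau^2. *)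
Lemma kernel_integral_ge x tau : 0 < tau <= 1 -> 1 <= x ^+ 2 -> t0 <= x ^+ 2 ->
  c0 * expR (- 2^-1) / 5 * (tau / x ^+ 2) <=
  \int[mu]_(t in HA) (marginal_kernel x tau t * w t).
Proof.
move=> tau01 y1 yt0; have /andP[tau0 tau1] := tau01.
have y0 : 0 < x ^+ 2 by exact: lt_le_trans y1.
have a0 : 0 < x ^+ 2 / tau ^+ 2 by rewrite divr_gt0// exprn_gt0.
have fi := integrable_kernel_mixing hL_pos hL_meas hK hpi1 x tau.
have sub : [set` `[x ^+ 2 / tau ^+ 2, 2 * x ^+ 2 / tau ^+ 2]] `<=` HA.
  by apply: subset_itv_pos; rewrite ?(ltW a0)// gt_eqF.
apply: (@le_trans _ _ (\int[mu]_(t in `[x ^+ 2 / tau ^+ 2, 2 * x ^+ 2 / tau ^+ 2])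
   (marginal_kernel x tau t * w t))); last first.
  apply: Rintegral_ge0_le_subset => // t /=; rewrite in_itv/= andbT => t_pos.
  by rewrite mulr_ge0// ltW ?marginal_kernel_gt0 ?mixing_weight_gt0.
have ab : x ^+ 2 / tau ^+ 2 <= 2 * x ^+ 2 / tau ^+ 2 by rewrite -mulrA; lra.
apply: le_trans (Rintegral_itv_ge (k := c0 * expR (- 2^-1) * tau ^+ 3 / (5 * (x ^+ 2) ^+ 2)) ab _ _).
- rewrite le_eqVlt; apply/orP; left; apply/eqP; field.
  have x0 : x != 0 by apply: contraTneq y0 => ->; rewrite expr0n ltxx.
  by rewrite x0 gt_eqF.
- by apply: integrableS fi.
- by move=> t; rewrite in_itv/=; exact: kernel_mixing_ge.
Qed.

(** For u = t tau^2 <= 1 / x^2 one has (x^2 - 1)(1 + u) <= x^2, so the exponent x^2 / (2 (1 + u))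
    falls short of x^2 / 2 by at most 1/2. *)
Lemma kernel_integral_near0_le x tau : 0 < tau <= 1 -> 1 <= x ^+ 2 ->
  \int[mu]_(t in `]0, (x ^+ 2 * tau ^+ 2)^-1]) (marginal_kernel x tau t * w t) <=
  expR (2^-1 - x ^+ 2 / 2) * K^-1.
Proof.
move=> /andP[tau0 tau1] y1; have y0 : 0 < x ^+ 2 by exact: lt_le_trans y1.
have tau20 : 0 < tau ^+ 2 by rewrite exprn_gt0.
have a0 : 0 < (x ^+ 2 * tau ^+ 2)^-1 by rewrite invr_gt0 mulr_gt0.
have fi := integrable_kernel_mixing hL_pos hL_meas hK hpi1 x tau.
have wi := integrable_mixing_weight hL_pos hL_meas hK hpi1.
have sub : [set` `]0, (x ^+ 2 * tau ^+ 2)^-1]] `<=` HA by apply: subset_itv_pos; rewrite ?eqxx.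
rewrite -(Rintegral_mixing_weight hK hpi1) -RintegralZl//.
apply: (@le_trans _ _ (\int[mu]_(t in `]0, (x ^+ 2 * tau ^+ 2)^-1])
    (expR (2^-1 - x ^+ 2 / 2) * w t))); last first.
  apply: Rintegral_ge0_le_subset => //; first exact: integrable_scale.
  move=> t /=; rewrite in_itv/= andbT => t_pos.
  by rewrite mulr_ge0 ?expR_ge0// ltW// mixing_weight_gt0.
apply: le_Rintegral => //.
- by apply: integrableS fi.
- by apply: integrableS (integrable_scale _ _ wi).
move=> t /=; rewrite in_itv/= => /andP[t_pos ta].
rewrite ler_wpM2r ?(ltW (mixing_weight_gt0 hL_pos t_pos))//.
rewrite -[2^-1 - _]opprK opprB; apply: marginal_kernel_le => //.
have a1 := affine_square_gt0 tau t_pos.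
have u1 : t * tau ^+ 2 * x ^+ 2 <= 1.
  have z0 : 0 < x ^+ 2 * tau ^+ 2 by rewrite mulr_gt0.
  by move: ta; rewrite -[X in _ <= X]div1r ler_pdivlMr//; lra.
rewrite ler_pdivlMr ?mulr_gt0//.
have u0 : 0 <= t * tau ^+ 2 by rewrite mulr_ge0 ?ltW.
move: u1 u0 y1; set u := t * _; set y := x ^+ 2 => u1 u0 y1; lra.
Qed.

(** The cut u <= 7 makes 2 (1 + u) <= 16. The integrand is bounded by its supremum and multiplied by
    an interval length below 7 / tau^2. *)
Lemma kernel_integral_middle_le x tau : 0 < tau <= 1 -> 1 <= x ^+ 2 ->
  \int[mu]_(t in `](x ^+ 2 * tau ^+ 2)^-1, 7 / tau ^+ 2]) (marginal_kernel x tau t * w t) <=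
  7 * M * tau * (x ^+ 2) ^+ 2 * expR (- (x ^+ 2 / 16)).
Proof.
move=> /andP[tau0 tau1] y1; have y0 : 0 < x ^+ 2 by exact: lt_le_trans y1.
have M0 := M_gt0 hL_pos hM.
have tau20 : 0 < tau ^+ 2 by rewrite exprn_gt0.
have a0 : 0 < (x ^+ 2 * tau ^+ 2)^-1 by rewrite invr_gt0 mulr_gt0.
have fi := integrable_kernel_mixing hL_pos hL_meas hK hpi1 x tau.
have sub : [set` `](x ^+ 2 * tau ^+ 2)^-1, 7 / tau ^+ 2]] `<=` HA.
  by apply: subset_itv_pos; rewrite ?(ltW a0)// gt_eqF.
have ab : (x ^+ 2 * tau ^+ 2)^-1 <= 7 / tau ^+ 2.
  rewrite invfM ler_pM2r ?invr_gt0//; apply: (@le_trans _ _ 1); last by lra.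
  by rewrite invf_le1.
apply: (le_trans (Rintegral_itv_le
   (k := expR (- (x ^+ 2 / 16)) * (M * ((x ^+ 2) ^+ 2 * tau ^+ 3))) ab _ _)).
- by apply: integrableS fi.
- move=> t; rewrite in_itv/= => /andP[at_ tb].
  have t_pos : 0 < t by exact: lt_trans at_.
  have ky0 := ltW (marginal_kernel_gt0 x tau t_pos).
  have w0 := ltW (mixing_weight_gt0 hL_pos t_pos).
  rewrite ler_pM//.
    apply: marginal_kernel_le => //.
    rewrite ler_pM2l// lef_pV2 ?posrE ?mulr_gt0 ?affine_square_gt0//.
    have : t * tau ^+ 2 <= 7 by rewrite -ler_pdivlMr.
    lra.
  have r0 : 0 < Num.sqrt t by rewrite sqrtr_gt0.
  rewrite /mixing_weight powR_threehalves// mulrC ler_pM ?invr_ge0 ?(ltW (hL_pos _))//.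
  + by rewrite mulr_ge0// ltW.
  + exact: hM.
  have p1 : 0 < x ^+ 2 * tau by exact: mulr_gt0.
  have p3 : 0 < (x ^+ 2) ^+ 2 * tau ^+ 3 by apply: mulr_gt0; exact: exprn_gt0.
  rewrite -[leRHS]invrK lef_pV2 ?posrE ?invr_gt0 ?(mulr_gt0 t_pos r0)//.
  (* The first factor bounds t from below and the second bounds sqrt t; the latter is slightly
     lossy, using x^2 >= 1 to avoid a half-integer power of x^2. *)
  have -> : ((x ^+ 2) ^+ 2 * tau ^+ 3)^-1 = (x ^+ 2 * tau ^+ 2)^-1 * (x ^+ 2 * tau)^-1.
    have x0 : x != 0 by apply: contraTneq y0 => ->; rewrite expr0n ltxx.
    by field; rewrite x0 gt_eqF.
  rewrite ler_pM ?(ltW at_) ?(ltW a0) ?invr_ge0 ?(ltW p1)//.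
  rewrite -[leLHS]ger0_norm ?invr_ge0 ?(ltW p1)//.
  rewrite -sqrtr_sqr ler_wsqrtr// (le_trans _ (ltW at_))//.
  rewrite exprVn lef_pV2 ?posrE ?(exprn_gt0 _ p1) ?(mulr_gt0 y0 tau20)//.
  by rewrite exprMn ler_pM2r// (expr2 (x ^+ 2)) ler_peMr// ltW.
apply: (@le_trans _ _ (expR (- (x ^+ 2 / 16)) * (M * ((x ^+ 2) ^+ 2 * tau ^+ 3)) *
   (7 / tau ^+ 2))).
  rewrite ler_wpM2l//; last by rewrite gerBl ltW.
  have p3 : 0 < (x ^+ 2) ^+ 2 * tau ^+ 3 by apply: mulr_gt0; exact: exprn_gt0.
  by rewrite (mulr_ge0 (expR_ge0 _))// (mulr_ge0 (ltW M0))// ltW.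
rewrite le_eqVlt; apply/orP; left; apply/eqP; field.
by rewrite gt_eqF.
Qed.

(** Fourth power of e^z >= z at z = y / 64. Relative to tau / x^2 the middle range carries exactly
    the factor on the left, which must become small. *)
Lemma cube_expR_le (y : R) : 0 < y -> y ^+ 3 * expR (- (y / 16)) <= 64 ^+ 4 / y.
Proof.
move=> y0; have h : (y / 64) ^+ 4 <= expR (y / 16).
  have -> : y / 16 = 4%:R * (y / 64) by field.
  rewrite expRM_natl lerXn2r ?nnegrE ?expR_ge0 ?divr_ge0 ?(ltW y0)//.
  by rewrite (le_trans _ (expR_ge1Dx _))// lerDr.
rewrite expRN ler_pdivlMr// mulrAC -exprSr ler_pdivrMr ?expR_gt0//.
by move: h; rewrite expr_div_n ler_pdivrMr ?exprn_gt0// mulrC.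
Qed.

(* Put u = t tau^2. The range u <= 7, where the shrinkage weight u / (1 + u) may
   be small, carries negligible mass: the kernel is of order e^(-x^2/2) for
   u <= 1/x^2 and at most e^(-x^2/16) for u <= 7, while the range
   x^2 <= u <= 2 x^2 alone contributes at least a multiple of tau / x^2. *)
Lemma shrinkage_mean_ge : exists c2 Y0 : R, [/\ 0 < c2, 1 <= Y0 &
  forall x tau, 0 < tau <= 1 -> Y0 <= x ^+ 2 ->
    x ^+ 2 * expR (- (x ^+ 2 / 2)) <= c2 * tau ->
    3 / 4 <= shrinkage_mean 2^-1 L tau x].
Proof.
have M0 := M_gt0 hL_pos hM.
pose c3 := c0 * expR (- 2^-1) / 5.
have c30 : 0 < c3 by rewrite divr_gt0// mulr_gt0 ?expR_gt0.
(* Each of the two ranges below u = 7 is to cost at most 1/16 of c3 tau / x^2. For the first this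
   fixes [c2]; for the second it needs 7 M 64^4 / x^2 <= c3 / 16, whence 112 = 7 * 16. *)
exists (c3 * K * expR (- 2^-1) / 16), (1 + t0 + 64 ^+ 4 * 112 * M / c3).
have Y1 : 0 < 64 ^+ 4 * 112 * M / c3 by rewrite divr_gt0// mulr_gt0// mulr_gt0// exprn_gt0.
split; first by rewrite divr_gt0// !mulr_gt0// expR_gt0.
  by rewrite -addrA lerDl addr_ge0// ltW.
move=> x tau tau01 Yx hx; have /andP[tau0 tau1] := tau01.
have y1 : 1 <= x ^+ 2 by rewrite (le_trans _ Yx)// -addrA lerDl addr_ge0// ltW.
have yt0 : t0 <= x ^+ 2 by move: ht0 Y1 Yx; lra.
have yY : 64 ^+ 4 * 112 * M / c3 <= x ^+ 2 by move: ht0 Y1 Yx; lra.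
have y0 : 0 < x ^+ 2 by exact: lt_le_trans y1.
have tau20 : 0 < tau ^+ 2 by rewrite exprn_gt0.
pose a := (x ^+ 2 * tau ^+ 2)^-1; pose b := 7 / tau ^+ 2.
have a0 : 0 < a by rewrite invr_gt0 mulr_gt0.
have b0 : 0 < b by rewrite divr_gt0.
have ab : a <= b.
  rewrite /a invfM ler_pM2r ?invr_gt0//; apply: (@le_trans _ _ 1); last by lra.
  by rewrite invf_le1.
pose f t := marginal_kernel x tau t * w t.
have f0 t : 0 < t -> 0 < f t.
  by move=> t_pos; rewrite mulr_gt0 ?marginal_kernel_gt0 ?mixing_weight_gt0.
have fi : mu.-integrable HA (EFin \o f) := integrable_kernel_mixing hL_pos hL_meas hK hpi1 x tau.
have gi : mu.-integrable HA (EFin \o (fun t => t * tau ^+ 2 / (1 + t * tau ^+ 2) * f t)) :=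
  integrable_shrink_kernel_mixing hL_pos hL_meas hK hpi1 x tau.
have F_ge := kernel_integral_ge tau01 y1 yt0.
have G1 := kernel_integral_near0_le tau01 y1.
have G2 := kernel_integral_middle_le tau01 y1.
rewrite -/c3 -/f in F_ge G1 G2.
have D0 : 0 < \int[mu]_(t in HA) f t := kernel_integral_gt0 hL_pos hL_meas hK hpi1 x tau.
rewrite shrinkage_meanE ler_pdivlMr//.
have split1 : \int[mu]_(t in HA) f t - \int[mu]_(t in `]0, b]) f t =
    \int[mu]_(t in `]b, +oo[) f t.
  by rewrite Rintegral_itvB// bnd_simp ltW.
have subb : [set` `]0, b]] `<=` HA by apply: subset_itv_pos; rewrite ?eqxx.
have split2 : \int[mu]_(t in `]0, b]) f t - \int[mu]_(t in `]0, a]) f t =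
    \int[mu]_(t in `]a, b]) f t.
  rewrite Rintegral_itvB// ?bnd_simp ?(ltW a0)//.
  by apply: integrableS fi.
have subc : [set` `]b, +oo[] `<=` HA.
  by apply: subset_itv_pos; rewrite ?(ltW b0)// gt_eqF.
have N_ge : 7 / 8 * (\int[mu]_(t in `]b, +oo[) f t) <=
    \int[mu]_(t in HA) (t * tau ^+ 2 / (1 + t * tau ^+ 2) * f t).
  apply: (@le_trans _ _ (\int[mu]_(t in `]b, +oo[) (t * tau ^+ 2 / (1 + t * tau ^+ 2) * f t))).
    rewrite -RintegralZl//; last by apply: integrableS fi.
    apply: le_Rintegral => //.
    - by apply: integrable_scale => //; apply: integrableS fi.
    - by apply: integrableS gi.
    move=> t /=; rewrite in_itv/= andbT => bt; have t_pos := lt_trans b0 bt.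
    rewrite ler_wpM2r ?(ltW (f0 _ t_pos))//.
    have a1 := affine_square_gt0 tau t_pos.
    have : 7 <= t * tau ^+ 2 by rewrite -ler_pdivrMr// ltW.
    rewrite ler_pdivlMr//; lra.
  apply: Rintegral_ge0_le_subset => // t /=; rewrite in_itv/= andbT => t_pos.
  by rewrite mulr_ge0 ?(ltW (f0 _ t_pos))//; have /andP[] := shrink_weight_bounds tau t_pos.
have G1' : \int[mu]_(t in `]0, a]) f t <= c3 * (tau / x ^+ 2) / 16.
  apply: (le_trans G1).
  have -> : expR (2^-1 - x ^+ 2 / 2) * K^-1 =
      (x ^+ 2 * expR (- (x ^+ 2 / 2))) * (expR 2^-1 / (K * x ^+ 2)).
    rewrite expRD; field.
    have x0 : x != 0 by apply: contraTneq y0 => ->; rewrite expr0n ltxx.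
    by rewrite x0 gt_eqF.
  apply: (le_trans (ler_wpM2r _ hx)).
    by rewrite divr_ge0 ?expR_ge0// (mulr_ge0 (ltW hK) (ltW y0)).
  rewrite expRN le_eqVlt; apply/orP; left; apply/eqP; field.
  have x0 : x != 0 by apply: contraTneq y0 => ->; rewrite expr0n ltxx.
  by rewrite x0 !gt_eqF ?expR_gt0.
have G2' : \int[mu]_(t in `]a, b]) f t <= c3 * (tau / x ^+ 2) / 16.
  apply: (le_trans G2).
  have -> : 7 * M * tau * (x ^+ 2) ^+ 2 * expR (- (x ^+ 2 / 16)) =
      7 * M * (tau / x ^+ 2) * ((x ^+ 2) ^+ 3 * expR (- (x ^+ 2 / 16))).
    field.
    by apply: contraTneq y0 => ->; rewrite expr0n ltxx.
  have q0 : 0 <= tau / x ^+ 2 by rewrite divr_ge0 ?ltW.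
  have h := cube_expR_le y0.
  have h2 : 64 ^+ 4 / x ^+ 2 <= c3 / (112 * M).
    rewrite ler_pdivrMr// mulrAC ler_pdivlMr ?mulr_gt0//.
    by move: yY; rewrite ler_pdivrMr// (mulrC c3); apply: le_trans; rewrite mulrA.
  apply: (@le_trans _ _ (7 * M * (tau / x ^+ 2) * (c3 / (112 * M)))).
    apply: ler_wpM2l (le_trans h h2).
    by apply: mulr_ge0 => //; apply: mulr_ge0 => //; exact: ltW.
  rewrite le_eqVlt; apply/orP; left; apply/eqP; field.
  have x0 : x != 0 by apply: contraTneq y0 => ->; rewrite expr0n ltxx.
  by rewrite x0 gt_eqF.
rewrite -/f; move: F_ge G1' G2' D0 N_ge split1 split2.
set F := \int[mu]_(t in HA) f t; set N := \int[mu]_(t in HA) _.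
set B := \int[mu]_(t in `]0, b]) _; set B1 := \int[mu]_(t in `]0, a]) _.
set B2 := \int[mu]_(t in `]a, b]) _; set C := \int[mu]_(t in `]b, +oo[) _.
(* The ranges below u = 7 take at most 1/8 of the total, and above it the shrinkage weight is at
   least 7/8; 49/64 exceeds 3/4. *)
by move: (c3 * _) => z; lra.
Qed.

End ShrinkageLowerBound.

(** * Posterior averages over tau, for a prior density [p] and a likelihood [Q] *)

Section WeightedMean.
Context {R : realType}.
Local Notation mu := (@lebesgue_measure R).
Local Notation HA := (`]0, +oo[%classic : set R).

Context (p Q : R -> R) (B : R) (hp : is_density p) (mQ : measurable_fun setT Q)
  (hQ : forall t, 0 < t -> 0 < Q t <= B).

Let u t := p t * Q t.

Lemma density_ge0 t : HA t -> 0 <= p t.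
Proof. by rewrite /= in_itv/= andbT => t0; case: hp => _ + _; apply. Qed.

Lemma integrable_density : mu.-integrable HA (EFin \o p).
Proof.
case: (hp) => mp p0 p1; apply/integrableP; split; first exact/measurable_EFinP.
rewrite (_ : integral _ _ _ = 1%E) ?ltry// -p1.
by apply: eq_integral => t /[!inE] /density_ge0 pt; rewrite /= ger0_norm.
Qed.

Lemma tilted_density_ge0 t : HA t -> 0 <= u t.
Proof.
move=> t0; rewrite mulr_ge0 ?density_ge0//.
by move: t0; rewrite /= in_itv/= andbT => /hQ /andP[/ltW].
Qed.

Lemma integrable_tilted_density : mu.-integrable HA (EFin \o u).
Proof.
have Bp : mu.-integrable HA (EFin \o (fun t => B * p t)).
  by apply: integrable_scale => //; exact: integrable_density.
have le_B (t : R) : HA t -> `|u t| <= `|B * p t|.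
  move=> t0; have pt := density_ge0 t0; have ut := tilted_density_ge0 t0.
  move: t0; rewrite /= in_itv/= andbT => /hQ /andP[Q0 QB].
  have B0 : 0 <= B by rewrite (le_trans (ltW Q0)).
  by rewrite (ger0_norm ut) (ger0_norm (mulr_ge0 B0 pt)) (mulrC B) ler_wpM2l.
apply: (le_integrable _ _ _ Bp) => //.
apply/measurable_EFinP; apply: measurable_funM; first by case: hp.
exact: measurable_funTS.
Qed.

Lemma tilted_mass_gt0 : 0 < \int[mu]_(t in HA) u t.
Proof.
have ui := integrable_tilted_density.
rewrite lt_neqAle Rintegral_ge0 ?andbT; last by move=> t /tilted_density_ge0.
apply/eqP => /esym I0.
have E0 : (\int[mu]_(x in HA) `|(EFin \o u) x| = 0)%E.
  transitivity (\int[mu]_(x in HA) (EFin \o u) x)%E.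
    by apply: eq_integral => x /[!inE] Dx /=; rewrite ger0_norm// tilted_density_ge0.
  have I_fin : (\int[mu]_(x in HA) (EFin \o u) x)%E \is a fin_num.
    exact: integrable_fin_num.
  by rewrite -(fineK I_fin); congr EFin.
have mu_ := measurable_int mu ui.
have mHA : measurable HA by exact: measurable_itv.
have /(ae_eq_integral_abs mu mHA mu_) [N [mN N0 DN]] := E0.
have mp := measurable_int mu integrable_density.
have : (\int[mu]_(x in HA) `|(EFin \o p) x| = 0)%E.
  apply/(ae_eq_integral_abs mu mHA mp); exists N; split => // x /= h; apply: DN => /= k.
  apply: h => xHA; have := k xHA; move: xHA; rewrite /u/= in_itv/= andbT => /hQ /andP[Q0 _] [].
  by move/eqP; rewrite mulf_eq0 (gt_eqF Q0) orbF => /eqP ->.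
case: hp => _ p0 p1; apply/eqP.
rewrite (_ : integral _ _ _ = 1%E) ?oner_eq0// -p1.
by apply: eq_integral => t /[!inE] /density_ge0 pt; rewrite /= ger0_norm.
Qed.

Context (D : set R) (s : R -> R) (mD : measurable D) (DHA : D `<=` HA)
  (ms : measurable_fun setT s) (s01 : forall t, D t -> 0 <= s t <= 1).

Let Z := \int[mu]_(t in HA) u t.

Lemma integrable_tilted_density_sub : mu.-integrable D (EFin \o u).
Proof. by apply: integrableS integrable_tilted_density. Qed.

Lemma integrable_weighted : mu.-integrable D (EFin \o (fun t => s t * u t)).
Proof.
have le_u (t : R) : D t -> `|s t * u t| <= `|u t|.
  move=> Dt; have /andP[s0 s1] := s01 Dt; have ut := tilted_density_ge0 (DHA Dt).
  by rewrite (ger0_norm ut) (ger0_norm (mulr_ge0 s0 ut)) ler_piMl.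
have ui := integrable_tilted_density_sub.
apply: (le_integrable _ _ _ ui) => //.
apply/measurable_EFinP; apply: measurable_funM; first exact: measurable_funTS.
by have /measurable_EFinP := measurable_int mu ui.
Qed.

Lemma weighted_mean_scale :
  \int[mu]_(t in D) (s t * (u t / Z)) = (\int[mu]_(t in D) (s t * u t)) / Z.
Proof.
by under eq_Rintegral do rewrite mulrA; rewrite RintegralZr//; exact: integrable_weighted.
Qed.

Lemma weighted_mean_le k : 0 <= k -> (forall t, D t -> s t <= k) ->
  \int[mu]_(t in D) (s t * (u t / Z)) <= k.
Proof.
move=> k0 sk; rewrite weighted_mean_scale ler_pdivrMr ?tilted_mass_gt0//.
have ui := integrable_tilted_density_sub.
apply: (@le_trans _ _ (k * \int[mu]_(t in D) u t)).
  rewrite -RintegralZl//; apply: le_Rintegral => //.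
  - exact: integrable_weighted.
  - exact: integrable_scale.
  by move=> t Dt; rewrite ler_wpM2r ?sk ?tilted_density_ge0//; exact: DHA.
rewrite ler_wpM2l//; apply: Rintegral_ge0_le_subset => //.
- exact: integrable_tilted_density.
- exact: tilted_density_ge0.
Qed.

(** The normalizer [Z] runs over the whole half-line and the mean only over [D], so a lower bound
    requires that [p] put all its mass on [D]; the upper bound only needs the mass on [D] to be at
    most [Z]. *)
Lemma weighted_mean_ge k : 0 <= k -> (forall t, D t -> k <= s t) ->
  (\int[mu]_(t in D) (p t)%:E = 1)%E ->
  k <= \int[mu]_(t in D) (s t * (u t / Z)).
Proof.
move=> k0 sk pD; rewrite weighted_mean_scale ler_pdivlMr ?tilted_mass_gt0//.
have ui := integrable_tilted_density_sub.
have mHA : measurable HA by exact: measurable_itv.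
have ZE : Z = \int[mu]_(t in D) u t.
  have HAE : HA = D `|` (HA `\` D) by rewrite setDUK.
  have mC : measurable (HA `\` D) by exact: measurableD.
  have disj : [disjoint D & HA `\` D].
    by apply/disj_set2P; rewrite setDE setIA setIAC setICr set0I.
  rewrite /Z [in LHS]HAE Rintegral_setU//; last first.
    by rewrite -HAE; exact: integrable_tilted_density.
  rewrite -[RHS]addr0; congr (_ + _).
  have p0 : \int[mu]_(t in HA `\` D) p t = 0.
    have : \int[mu]_(t in D `|` (HA `\` D)) p t =
      \int[mu]_(t in D) p t + \int[mu]_(t in HA `\` D) p t.
      by rewrite Rintegral_setU// -HAE; exact: integrable_density.
    rewrite -HAE /Rintegral pD; case: hp => _ _ ->/=; lra.
  apply/eqP; rewrite eq_le Rintegral_ge0 ?andbT; last first.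
    by move=> t [/tilted_density_ge0].
  (* Boundedness of the likelihood carries the zero mass of the prior off [D] over to the
     posterior. *)
  apply: (@le_trans _ _ (B * \int[mu]_(t in HA `\` D) p t)); last by rewrite p0 mulr0.
  rewrite -RintegralZl//; last first.
    by apply: integrableS integrable_density => //; exact: subDsetl.
  apply: le_Rintegral => //.
  - by apply: integrableS integrable_tilted_density => //; exact: subDsetl.
  - by apply: integrable_scale => //; apply: integrableS integrable_density => //; exact: subDsetl.
  move=> t [t0 _]; have pt := density_ge0 t0; move: t0.
  by rewrite /= in_itv/= andbT => /hQ /andP[Q0 QB]; rewrite (mulrC B) ler_wpM2l.
rewrite ZE -RintegralZl//; apply: le_Rintegral => //.
- exact: integrable_scale.
- exact: integrable_weighted.
by move=> t Dt; rewrite ler_wpM2r ?sk ?tilted_density_ge0//; exact: DHA.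
Qed.

End WeightedMean.

(** * From bounds on the shrinkage mean to decisions of the full Bayes rule *)

Section FullBayesRule.
Context {R : realType}.
Local Notation mu := (@lebesgue_measure R).
Local Notation HA := (`]0, +oo[%classic : set R).

Context (L : R -> R) (K : R) (hL_pos : forall t, 0 < t -> 0 < L t)
  (hL_meas : measurable_fun HA L) (hK : 0 < K)
  (hpi1 : is_density (local_prior 2^-1 K L)).

Local Notation w := (mixing_weight L).

Lemma marginal_densityE (tau x : R) : marginal_density 2^-1 K L tau x =
  K / Num.sqrt (2 * pi) * \int[mu]_(t in HA) (marginal_kernel x tau t * w t).
Proof.
rewrite -RintegralZl//; last exact: (integrable_kernel_mixing hL_pos hL_meas hK hpi1).
apply: eq_Rintegral => t; rewrite inE /= in_itv/= andbT => t0.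
rewrite local_priorE /marginal_kernel sqrtrM ?mulr_ge0 ?pi_ge0// invfM; ring.
Qed.

Lemma marginal_kernel_integral_le x tau :
  \int[mu]_(t in HA) (marginal_kernel x tau t * w t) <= K^-1.
Proof.
rewrite -(Rintegral_mixing_weight hK hpi1); apply: le_Rintegral => //.
- exact: (integrable_kernel_mixing hL_pos hL_meas hK hpi1).
- exact: (integrable_mixing_weight hL_pos hL_meas hK hpi1).
move=> t /=; rewrite in_itv/= andbT => t0.
by rewrite ler_piMl ?marginal_kernel_le1// ltW// mixing_weight_gt0.
Qed.

Lemma sqrt_2pi_gt0 : 0 < Num.sqrt (2 * pi) :> R.
Proof. by rewrite sqrtr_gt0 mulr_gt0 ?pi_gt0. Qed.

Lemma marginal_density_bounds tau x :
  0 < marginal_density 2^-1 K L tau x <= (Num.sqrt (2 * pi))^-1.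
Proof.
have p0 := sqrt_2pi_gt0.
have I0 := kernel_integral_gt0 hL_pos hL_meas hK hpi1 x tau.
rewrite marginal_densityE mulr_gt0 ?divr_gt0//=.
apply: le_trans (ler_wpM2l _ (marginal_kernel_integral_le x tau)) _.
  by rewrite divr_ge0 ?ltW.
by rewrite mulrAC mulfV ?gt_eqF// mul1r.
Qed.

Lemma measurable_marginal_density x :
  measurable_fun setT (fun tau : R => marginal_density 2^-1 K L tau x).
Proof.
under eq_fun do rewrite marginal_densityE.
by apply: measurable_funM => //; exact: (measurable_kernel_integral hL_pos hL_meas).
Qed.

Lemma shrinkage_mean_bounds tau x : 0 <= shrinkage_mean 2^-1 L tau x <= 1.
Proof.
have I0 := kernel_integral_gt0 hL_pos hL_meas hK hpi1 x tau.
have f0 (t : R) : 0 < t -> 0 <= marginal_kernel x tau t * w t.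
  by move=> t0; rewrite mulr_ge0// ltW ?marginal_kernel_gt0 ?mixing_weight_gt0.
rewrite shrinkage_meanE divr_ge0 ?(ltW I0)//=; last first.
  apply: Rintegral_ge0 => t /=; rewrite in_itv/= andbT => t0.
  by have /andP[s0 _] := shrink_weight_bounds tau t0; rewrite mulr_ge0 ?f0.
rewrite ler_pdivrMr// mul1r; apply: le_Rintegral => //.
- exact: (integrable_shrink_kernel_mixing hL_pos hL_meas hK hpi1).
- exact: (integrable_kernel_mixing hL_pos hL_meas hK hpi1).
move=> t /=; rewrite in_itv/= andbT => t0.
by have /andP[_ s1] := shrink_weight_bounds tau t0; rewrite ler_piMl ?f0.
Qed.

Lemma posterior_weight_bounds (n : nat) (X : 'rV[R]_n) tau :
  0 < \prod_(i < n) marginal_density 2^-1 K L tau (X 0 i)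
    <= ((Num.sqrt (2 * pi))^-1) ^+ n.
Proof.
rewrite prodr_gt0 => [|i _]; last by have /andP[] := marginal_density_bounds tau (X 0 i).
rewrite -[X in _ ^+ X]card_ord -prodr_const /=; apply: ler_prod => i _.
by have /andP[/ltW -> ->] := marginal_density_bounds tau (X 0 i).
Qed.

Lemma measurable_posterior_weight (n : nat) (X : 'rV[R]_n) : measurable_fun setT
  (fun tau : R => \prod_(i < n) marginal_density 2^-1 K L tau (X 0 i)).
Proof. by apply: measurable_prod => i _; exact: measurable_marginal_density. Qed.

Context (p : R -> R) (hp : is_density p) (n : nat) (hn : (0 < n)%N) (alpha : R).

Lemma itv_invn_pos : [set` `[(n%:R^-1 : R), alpha]] `<=` HA.
Proof.
move=> t /=; rewrite !in_itv/= andbT => /andP[h _].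
by rewrite (lt_le_trans _ h)// invr_gt0 ltr0n.
Qed.

Lemma full_bayes_rule_false (X : 'rV[R]_n) (i : 'I_n) :
  (forall tau, n%:R^-1 <= tau <= alpha -> shrinkage_mean 2^-1 L tau (X 0 i) <= 2^-1) ->
  full_bayes_rule 2^-1 K L p alpha X i = false.
Proof.
move=> h; apply/negbTE; rewrite /full_bayes_rule -leNgt.
apply: (@weighted_mean_le R p (fun tau => \prod_(i < n) marginal_density 2^-1 K L tau (X 0 i))
  (((Num.sqrt (2 * pi))^-1) ^+ n) hp) => //.
- exact: measurable_posterior_weight.
- by move=> t _; exact: posterior_weight_bounds.
- exact: itv_invn_pos.
- exact: (measurable_shrinkage_mean hL_pos hL_meas).
- by move=> t _; exact: shrinkage_mean_bounds.
Qed.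

(** Selection requires the coefficient to exceed 1/2 strictly, hence a bound with a margin such as
    3/4. *)
Lemma full_bayes_rule_true (X : 'rV[R]_n) (i : 'I_n) :
  (\int[mu]_(t in `[(n%:R^-1)%R, alpha]) (p t)%:E = 1)%E ->
  (forall tau, n%:R^-1 <= tau <= alpha -> 3 / 4 <= shrinkage_mean 2^-1 L tau (X 0 i)) ->
  full_bayes_rule 2^-1 K L p alpha X i.
Proof.
move=> p1 h; rewrite /full_bayes_rule; apply: (@lt_le_trans _ _ (3 / 4)); first by lra.
apply: (@weighted_mean_ge R p (fun tau => \prod_(i < n) marginal_density 2^-1 K L tau (X 0 i))
  (((Num.sqrt (2 * pi))^-1) ^+ n) hp) => //.
- exact: measurable_posterior_weight.
- by move=> t _; exact: posterior_weight_bounds.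
- exact: itv_invn_pos.
- exact: (measurable_shrinkage_mean hL_pos hL_meas).
- by move=> t _; exact: shrinkage_mean_bounds.
Qed.

End FullBayesRule.

(** * The standard normal distribution function: symmetry, Lipschitz bound, tail *)

Section StandardNormal.
Context {R : realType}.
Local Notation mu := (@lebesgue_measure R).
Local Notation N01 := (normal_prob (0 : R) 1).
Local Notation pdf := (normal_pdf (0 : R) 1).
Local Notation peak := (normal_peak (1 : R)).
Implicit Types x y : R.

Lemma normal_pdf01E x : pdf x = peak * expR (- (x ^+ 2 / 2)).
Proof.
by rewrite normal_pdfE ?oner_eq0// /normal_fun subr0 expr1n mulNr.
Qed.

Lemma Phi_EFin x : (Phi x)%:E = N01 `]-oo, x].
Proof. by rewrite /Phi fineK// fin_num_measure. Qed.

Lemma normal_prob_itvcy x : N01 `[x, +oo[ = (Phi (- x))%:E.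
Proof.
rewrite Phi_EFin /normal_prob ge0_integration_by_substitutionNy; last 2 first.
- by apply: continuous_subspaceT; exact: continuous_normal_pdf (oner_neq0 _).
- by move=> t _; exact: normal_pdf_ge0.
by apply: eq_integral => t _ /=; rewrite !normal_pdf01E sqrrN.
Qed.

Lemma Phi_sub x y : x <= y -> N01 `]x, y] = (Phi y - Phi x)%:E.
Proof.
move=> xy; have H : (N01 `]-oo, y] = N01 `]-oo, x] + N01 `]x, y])%E.
  rewrite -measureU//; last first.
    rewrite -subset0 => t [] /=; rewrite !in_itv/= => tx /andP[xt _].
    by move: tx; rewrite leNgt xt.
  by congr (N01 _); rewrite -itv_bndbnd_setU// bnd_simp.
by rewrite EFinB !Phi_EFin H addeAC subee ?add0e// fin_num_measure.
Qed.

Lemma Phi_ge0 x : 0 <= Phi x.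
Proof. by rewrite /Phi fine_ge0. Qed.

Lemma le_Phi x y : x <= y -> Phi x <= Phi y.
Proof. by move=> xy; rewrite -lee_fin !Phi_EFin le_measure ?inE//; exact: subset_itvl. Qed.

Lemma Phi_lipschitz x y : x <= y -> Phi y - Phi x <= peak * (y - x).
Proof.
move=> xy; rewrite -lee_fin -Phi_sub// /normal_prob.
apply: (@le_trans _ _ (\int[mu]_(t in `]x, y]) peak%:E)%E).
  apply: ge0_le_integral => //.
  - by move=> t _; rewrite lee_fin normal_pdf_ge0.
  - by apply/measurable_EFinP; apply: measurable_funTS; exact: measurable_normal_pdf.
  - by move=> t _; rewrite lee_fin normal_pdf_ub// oner_neq0.
rewrite integral_cst//= lebesgue_measure_itv/= lte_fin.
by case: ltgtP xy => //= -> _; rewrite subrr mulr0 mule0.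
Qed.

Lemma one_minus_Phi x : 1 - Phi x = Phi (- x).
Proof.
have H : (N01 `]-oo, x] + N01 `]x, +oo[ = 1)%E.
  rewrite -measureU//; last first.
    rewrite -subset0 => t [] /=; rewrite !in_itv/= andbT => tx xt.
    by move: tx; rewrite leNgt xt.
  rewrite -itv_bndbnd_setU// ?bnd_simp// set_itvNyy.
  exact: integral_normal_pdf.
have E : N01 `]x, +oo[ = (Phi (- x))%:E.
  rewrite -normal_prob_itvcy /normal_prob integral_itv_obnd_cbnd//.
  by apply/measurable_EFinP; apply: measurable_funTS; exact: measurable_normal_pdf.
by move: H; rewrite E -Phi_EFin -EFinD => -[<-]; rewrite addrAC subrr add0r.
Qed.

Lemma integral_gauss_tail x : 0 <= x ->
  (\int[mu]_(t in `[x, +oo[) (t * expR (- (t ^+ 2 / 2)))%:E = (expR (- (x ^+ 2 / 2)))%:E)%E.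
Proof.
move=> x0; pose F (t : R) := - expR (- (t ^+ 2 / 2)).
have dF (t : R) : is_derive t 1 F (t * expR (- (t ^+ 2 / 2))).
  have h : is_derive t 1 (- (2^-1 \*: (@idfun R ^+ 2))) (- t).
    have := is_deriveN (is_deriveZ (2^-1) (is_deriveX 2 (is_derive_id t (1 : R)))).
    congr (is_derive _ _ _ _); rewrite /GRing.scale /=; by field.
  have := is_deriveN (is_derive1_comp (is_derive_expR _) h).
  have -> : (- (expR \o (- (2^-1 \*: (@idfun R ^+ 2))))) = F.
    by apply/funext => s; rewrite /F /= /GRing.scale /= mulrC.
  congr (is_derive _ _ _ _); rewrite /GRing.scale /= mulrN opprK mulrC; congr (_ * expR (- _)).
  by rewrite [RHS]mulrC.
have cF : continuous F.
  by move=> t; apply: differentiable_continuous; apply/derivable1_diffP; have [] := dF t.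
rewrite (@ge0_continuous_FTC2y _ _ F x 0).
- by rewrite -EFinB sub0r opprK.
- by move=> t xt; rewrite mulr_ge0 ?expR_ge0// (le_trans x0).
- apply: continuous_subspaceT => t; apply: cvgM; first exact: cvg_id.
  apply: (@continuous_comp _ _ _ (fun s : R => - (s ^+ 2 / 2)) expR); last exact: continuous_expR.
  apply: cvgN; apply: cvgM; last exact: cvg_cst.
  exact: exprn_continuous.
- rewrite -[X in _ --> X]oppr0; apply: cvgN.
  apply: (cvg_comp (fun t : R => t ^+ 2 / 2) (fun y => expR (- y))); last exact: cvgr_expR.
  under eq_fun do rewrite mulrC.
  have h2 : (0 : R) < 2^-1 by [].
  by apply: (gt0_cvgMry h2 (@cvgr_expr2 R)).
- by move=> t _; case: (dF t).
- by apply: cvg_at_right_filter; exact: cF.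
- by move=> t _; rewrite derive1E; apply/(@derive_val _ _ _ _ _ _ _ (dF t)).
Qed.

(** The Mills ratio bound: inserting t / x >= 1 makes the tail integrand an exact derivative. The
    factor 1 / x is essential later, since it supplies the (log n)^(-1/2). *)
Lemma normal_tail_le x : 0 < x -> Phi (- x) <= peak * (expR (- (x ^+ 2 / 2)) / x).
Proof.
move=> x0; rewrite -lee_fin -normal_prob_itvcy /normal_prob.
have p0 := normal_peak_ge0 (1 : R).
have mg : measurable_fun (`[x, +oo[%classic : set R) (fun t => t * expR (- (t ^+ 2 / 2))).
  apply: measurable_funTS; apply: measurable_funM => //.
  apply: measurableT_comp => //; apply: measurableT_comp => //.
  by apply: measurable_funM => //; exact: measurable_funX.
apply: (@le_trans _ _ (\int[mu]_(t in `[x, +oo[)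
    ((peak / x)%:E * (t * expR (- (t ^+ 2 / 2)))%:E))%E).
  apply: ge0_le_integral => //.
  - by move=> t _; rewrite lee_fin normal_pdf_ge0.
  - by apply/measurable_EFinP; apply: measurable_funTS; exact: measurable_normal_pdf.
  - by apply: measurable_funeM; exact/measurable_EFinP.
  - move=> t /=; rewrite in_itv/= andbT => xt.
    rewrite -EFinM lee_fin normal_pdf01E mulrA ler_wpM2r ?expR_ge0//.
    by rewrite mulrAC ler_pdivlMr// ler_wpM2l.
rewrite ge0_integralZl_EFin//.
- by rewrite integral_gauss_tail ?(ltW x0)// -EFinM lee_fin -mulrA (mulrC x^-1).
- move=> t /=; rewrite in_itv/= andbT => xt.
  by rewrite lee_fin mulr_ge0 ?expR_ge0// (le_trans (ltW x0)).
- exact/measurable_EFinP.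
- by rewrite divr_ge0// ltW.
Qed.

End StandardNormal.

(* The testing rule is not shown to be measurable, so its loss can only be
   compared with measurable bounds. *)
Lemma le_integral_ge0_nonmeasurable {d} {T : measurableType d} {R : realType}
    (mu : {measure set T -> \bar R}) (f g : T -> \bar R) :
  (forall x, (0 <= f x)%E) -> (forall x, (f x <= g x)%E) ->
  (\int[mu]_x f x <= \int[mu]_x g x)%E.
Proof.
move=> f0 fg; have g0 x : (0 <= g x)%E by exact: le_trans (f0 x) (fg x).
(* The integral of a nonnegative function is a supremum over simple functions below it, and
   enlarging the function enlarges that family. *)
rewrite !ge0_integralTE//; apply: le_ereal_sup => _ [h hf <-]; exists h => // x.
exact: le_trans (hf x) (fg x).
Qed.

(** * Risk of a rule squeezed between two thresholds on the absolute observation *)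

Section ThresholdRisk.
Context {R : realType} {d : measure_display} {T : measurableType d}
  {P : probability T R} {n : nat} (eps : 'I_n -> {RV P >-> R})
  (heps : iid_standard_normal eps).

Lemma noise_prob i (A : set R) : measurable A -> P (eps i @^-1` A) = normal_prob (0 : R) 1 A.
Proof. by move=> mA; rewrite -(heps.2 i A mA). Qed.

Lemma measurable_noise_event i (A : set R) : measurable A -> measurable (eps i @^-1` A).
Proof. by move=> mA; rewrite -[X in measurable X]setTI; exact: measurable_funP. Qed.

Lemma integral_sum_indic (A : 'I_n -> set R) : (forall i, measurable (A i)) ->
  (\int[P]_w (\sum_(i < n) \1_(eps i @^-1` A i) w)%:E =
   \sum_(i < n) normal_prob (0 : R) 1 (A i))%E.
Proof.
move=> mA; under eq_integral do rewrite -sumEFin.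
rewrite ge0_integral_sum//; last first.
  by move=> i; apply/measurable_EFinP; apply: measurable_indic; exact: measurable_noise_event.
apply: eq_bigr => i _; rewrite integral_indic ?setIT//; first exact: noise_prob.
exact: measurable_noise_event.
Qed.

Context (psi : 'rV[R]_n -> 'I_n -> bool) (lo hi : R) (hlo : 0 < lo).
Context (psi_lo : forall (X : 'rV[R]_n) (i : 'I_n), `|X 0 i| <= lo -> psi X i = false)
  (psi_hi : forall (X : 'rV[R]_n) (i : 'I_n), hi <= `|X 0 i| -> psi X i).

Implicit Type theta : 'rV[R]_n.

(** A set of noise values containing every error at coordinate i. For a signal, only the inequality
    on the side of its sign is kept from |X_i| < hi, so the probability is a single value of Phi. *)
Let error_event (theta : 'rV[R]_n) (i : 'I_n) : set R :=
  if theta 0 i == 0 then `]-oo, - lo] `|` `[lo, +oo[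
  else if 0 < theta 0 i then `]-oo, hi - `|theta 0 i|]%classic
  else `[- (hi - `|theta 0 i|), +oo[%classic.

Lemma measurable_error_event theta i : measurable (error_event theta i).
Proof.
rewrite /error_event; case: ifP => _; first exact: measurableU.
by case: ifP.
Qed.

Lemma error_event_prob (m : R) theta (i : 'I_n) :
  (theta 0 i != 0 -> m <= `|theta 0 i|) ->
  (normal_prob (0 : R) 1 (error_event theta i) <=
   (if theta 0%R i == 0%R then 2 * Phi (- lo) else Phi (hi - m))%:E)%E.
Proof.
rewrite /error_event; case: ifPn => [_ _|t0 /(_ isT) mt].
  apply: (le_trans (measureU2 _ _ _)) => //.
  change ((normal_prob (0 : R) 1 `]-oo, (- lo)%R] + normal_prob (0 : R) 1 `[lo, +oo[ <=
    (2 * Phi (- lo))%R%:E)%E).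
  by rewrite normal_prob_itvcy -Phi_EFin -EFinD mulr_natl mulr2n.
have h : Phi (hi - `|theta 0 i|) <= Phi (hi - m) by rewrite le_Phi// lerD2l lerN2.
case: ifP => _; first by rewrite -Phi_EFin lee_fin.
by rewrite normal_prob_itvcy opprK lee_fin.
Qed.

Lemma hamming_loss_le theta w :
  (hamming_loss theta (psi (\row_(i < n) (theta 0 i + eps i w))))%:R <=
  \sum_(i < n) \1_(eps i @^-1` error_event theta i) w :> R.
Proof.
rewrite /hamming_loss natr_sum; apply: ler_sum => i _; rewrite indicE.
set X := \row_(_ < _) _.
have XE : X 0 i = theta 0 i + eps i w by rewrite mxE.
have ind (b : bool) (B : Prop) : (b -> B) -> b%:R <= (`[< B >])%:R :> R.
  by case: b => h; rewrite ?ler0n//; move/asboolP: (h isT) => ->.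
rewrite /error_event; have [t0|t0] := eqVneq (theta 0 i) 0; rewrite /= ?addn0 ?add0n.
- apply: ind => hpsi /=; rewrite !in_itv/= andbT; apply/orP.
  have : ~~ (`|X 0 i| <= lo) by apply: contraL hpsi => /psi_lo ->.
  rewrite XE t0 add0r -ltNge ltr_normr => /orP[/ltW ->|]; first by rewrite orbT.
  by rewrite ltrNr => /ltW ->.
- have hX : ~~ psi X i -> `|X 0 i| < hi.
    by rewrite ltNge; apply: contraNN => /psi_hi.
  case: ifP => tp; apply: ind => /hX; rewrite XE /= in_itv/= ltr_norml => /andP[h1 h2].
    by rewrite gtr0_norm// lerBrDl ltW.
  have tn : theta 0 i < 0 by rewrite lt_neqAle t0 leNgt tp.
  by rewrite andbT ltr0_norm//; lra.
Qed.

Lemma classification_risk_le (q : nat) (b : R) theta : beta_min_class q b theta ->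
  (classification_risk eps psi theta <=
   (n%:R * (2 * Phi (- lo)) +
    q%:R * Phi (hi - (Num.sqrt (2 * ln (n%:R / q%:R)) + b)))%:E)%E.
Proof.
move=> [qE theta_ge]; rewrite /classification_risk unlock.
apply: (@le_trans _ _ (\int[P]_w (\sum_(i < n) \1_(eps i @^-1` error_event theta i) w)%:E)%E).
  apply: le_integral_ge0_nonmeasurable => w; rewrite lee_fin ?ler0n//.
  exact: hamming_loss_le.
rewrite integral_sum_indic; last exact: measurable_error_event.
set m := Num.sqrt _ + b.
apply: (@le_trans _ _ (\sum_(i < n)
   (if theta 0 i == 0 then 2 * Phi (- lo) else Phi (hi - m))%R%:E)%E).
  apply: lee_sum => i _; apply: error_event_prob => t0.
  by apply: theta_ge; rewrite inE.
rewrite sumEFin lee_fin (bigID (fun i => theta 0 i == 0))/= lerD//.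
- under eq_bigr => i t0 do rewrite t0.
  rewrite sumr_const -[_ *+ #|_|]mulr_natl ler_wpM2r ?mulr_ge0 ?Phi_ge0// ler_nat.
  by rewrite -[leqRHS]card_ord max_card.
- under eq_bigr => i /negbTE t0 do rewrite t0.
  rewrite sumr_const -[_ *+ #|_|]mulr_natl ler_wpM2r ?Phi_ge0// ler_nat.
  by rewrite -qE /signal_set; apply/eq_leq/eq_card => i; rewrite inE.
Qed.

(** Signals placed exactly at the beta-min boundary are the least favourable; positivity of [m]
    ensures that these q coordinates really are signals. *)
Lemma exists_worst_case (q : nat) (m : R) : (q <= n)%N -> 0 < m ->
  exists theta : 'rV[R]_n, #|signal_set theta| = q /\
    forall i, i \in signal_set theta -> theta 0 i = m.
Proof.
move=> qn m0; exists (\row_(i < n) (if (i < q)%N then m else 0)).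
have inS (i : 'I_n) : (i \in signal_set (\row_(i < n) (if (i < q)%N then m else 0))) = (i < q)%N.
  by rewrite inE mxE; case: ifP => _; rewrite ?eqxx// gt_eqF.
split=> [|i]; last by rewrite inS mxE => ->.
rewrite -sum1_card (eq_bigl _ _ inS) (big_ord_narrow qn).
by rewrite sum_nat_const card_ord muln1.
Qed.

(** Only missed signals are counted: a signal is certainly missed when its noise lies between -lo -
    m and lo - m. *)
Lemma classification_risk_ge (q : nat) (m : R) theta : 0 < m ->
  #|signal_set theta| = q ->
  (forall i, i \in signal_set theta -> theta 0 i = m) ->
  ((q%:R * (Phi (lo - m) - Phi (- lo - m)))%:E <= classification_risk eps psi theta)%E.
Proof.
move=> m0 qE theta_m; rewrite /classification_risk unlock.
pose A i : set R := if i \in signal_set theta then `](- lo - m), (lo - m)]%classic else set0.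
have mA i : measurable (A i) by rewrite /A; case: ifP.
apply: (@le_trans _ _ (\int[P]_w (\sum_(i < n) \1_(eps i @^-1` A i) w)%:E)%E); last first.
  apply: le_integral_ge0_nonmeasurable => w; rewrite lee_fin ?sumr_ge0//.
  rewrite /hamming_loss natr_sum; apply: ler_sum => i _; rewrite indicE /A.
  case: ifPn => [iS|_]; last by rewrite preimage_set0 in_set0 ler0n.
  move: (iS); rewrite inE => t0; rewrite (negbTE t0)/= add0n.
  set X := \row_(_ < _) _.
  have XE : X 0 i = m + eps i w by rewrite mxE theta_m.
  case: (boolP (w \in _)) => [|_]; last by rewrite ler0n.
  rewrite inE /= in_itv/= => /andP[h1 h2]; rewrite psi_lo//.
  by rewrite XE ler_norml; apply/andP; split; lra.
rewrite integral_sum_indic// (bigID (mem (signal_set theta)))/=.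
rewrite [X in (_ <= _ + X)%E]big1 ?adde0; last first.
  by move=> i /negbTE iS; rewrite /A iS measure0.
under eq_bigr => i iS do rewrite /A iS Phi_sub ?lerD2r ?ge0_cp ?(ltW hlo)//.
by rewrite sumEFin sumr_const qE mulr_natl.
Qed.

End ThresholdRisk.

(** * A bound on the scaled risk, for each n, with an error free of b *)

Section ScaledRisk.
Context {R : realType} {d : measure_display} {T : measurableType d}
  {P : probability T R} {n : nat} (eps : 'I_n -> {RV P >-> R})
  (heps : iid_standard_normal eps).
Context (psi : 'rV[R]_n -> 'I_n -> bool) (lo hi : R) (hlo : 0 < lo).
Context (psi_lo : forall (X : 'rV[R]_n) (i : 'I_n), `|X 0 i| <= lo -> psi X i = false)
  (psi_hi : forall (X : 'rV[R]_n) (i : 'I_n), hi <= `|X 0 i| -> psi X i).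
Local Notation peak := (normal_peak (1 : R)).

Lemma Phi_dist (x y : R) : `|Phi x - Phi y| <= peak * `|x - y|.
Proof.
wlog xy : x y / x <= y => [h|].
  by have [/h//|/ltW/h] := leP x y; rewrite distrC (distrC y).
rewrite distrC (distrC x) !ger0_norm ?subr_ge0 ?le_Phi//.
exact: Phi_lipschitz.
Qed.

Lemma scaled_max_risk_bounds (q : nat) (b : R) (S := Num.sqrt (2 * ln (n%:R / q%:R)))
    (r := n%:R * (2 * Phi (- lo)) + peak * `|hi - S| + peak * `|lo - S|) :
  (0 < q <= n)%N -> 0 < S + b ->
  ((- r)%:E <= scaled_max_risk eps psi q b - (1 - Phi b)%:E <= r%:E)%E.
Proof.
move=> /andP[q0 qn] Sb0; rewrite one_minus_Phi /scaled_max_risk.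
have qR0 : 0 < q%:R :> R by rewrite ltr0n.
have n1 : 1 <= n%:R :> R by rewrite ler1n (leq_trans q0).
have q1 : 1 <= q%:R :> R by rewrite ler1n.
have Plo := Phi_ge0 (- lo).
have nPlo : Phi (- lo) <= n%:R * (2 * Phi (- lo)).
  by rewrite -[leLHS]mul1r; apply: ler_pM => //; lra.
have phi0 : 0 <= peak * `|hi - S| by rewrite mulr_ge0 ?normal_peak_ge0.
have plo0 : 0 <= peak * `|lo - S| by rewrite mulr_ge0 ?normal_peak_ge0.
apply/andP; split.
- have [theta [thq thm]] := @exists_worst_case R n q (S + b) qn Sb0.
  have inB : beta_min_class q b theta.
    by split => // i iS; rewrite thm// ger0_norm ?(ltW Sb0).
  have := classification_risk_ge heps hlo psi_lo Sb0 thq thm.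
  have ub : (classification_risk eps psi theta <=
      ereal_sup [set classification_risk eps psi theta | theta in beta_min_class q b])%E.
    by apply: ereal_sup_ubound; exists theta.
  move=> /le_trans /(_ ub); rewrite -(@lee_pmul2l _ (q%:R^-1)%:E) ?lte_fin ?invr_gt0// => h.
  rewrite leeBrDr//; apply: le_trans h; rewrite -EFinD -EFinM lee_fin mulKf ?gt_eqF//.
  have h1 := Phi_dist (lo - (S + b)) (- b).
  have e1 : lo - (S + b) - - b = lo - S by ring.
  (* The probability of overshooting on the far side is absorbed by the false-positive term of
     [r]. *)
  have h2 : Phi (- lo - (S + b)) <= Phi (- lo) by rewrite le_Phi// gerBl ltW.
  rewrite e1 in h1; move: h1; rewrite ler_norml => /andP[h1 _].
  rewrite /r; lra.
- rewrite leeBlDr//.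
  apply: (@le_trans _ _ ((q%:R^-1)%:E * (n%:R * (2 * Phi (- lo)) + q%:R * Phi (hi - (S + b)))%:E)%E).
    rewrite lee_pmul2l ?lte_fin ?invr_gt0//; apply: ge_ereal_sup => _ [theta hth <-].
    exact: (classification_risk_le heps psi_lo psi_hi hth).
  rewrite -EFinD -EFinM lee_fin mulrDr mulKf ?gt_eqF//.
  have h1 := Phi_dist (hi - (S + b)) (- b).
  have e1 : hi - (S + b) - - b = hi - S by ring.
  rewrite e1 in h1; move: h1; rewrite ler_norml => /andP[_ h1].
  have h3 : q%:R^-1 * (n%:R * (2 * Phi (- lo))) <= n%:R * (2 * Phi (- lo)).
    by rewrite ler_piMl ?invf_le1//; lra.
  rewrite /r; lra.
Qed.

End ScaledRisk.

(** * Elementary inequalities and the scale in which the thresholds are compared *)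

Section Thresholds.
Context {R : realType}.

Lemma ln_le_self (x : R) : 0 < x -> ln x <= x.
Proof.
by move=> x0; rewrite -ler_expR lnK ?posrE// (le_trans _ (expR_ge1Dx x))// lerDr.
Qed.

Lemma sqrt_dist_le (a b m : R) : 0 < m -> m ^+ 2 <= a -> 0 <= b ->
  `|Num.sqrt a - Num.sqrt b| <= `|a - b| / m.
Proof.
move=> m0 ma b0; have a0 : 0 <= a by rewrite (le_trans _ ma)// sqr_ge0.
have msa : m <= Num.sqrt a.
  by rewrite -[leLHS]ger0_norm ?(ltW m0)// -sqrtr_sqr ler_wsqrtr.
have -> : a - b = (Num.sqrt a - Num.sqrt b) * (Num.sqrt a + Num.sqrt b).
  by rewrite -subr_sqr !sqr_sqrtr.
rewrite ler_pdivlMr// normrM ler_wpM2l// (le_trans msa)//.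
by rewrite (le_trans _ (ler_norm _))// lerDl sqrtr_ge0.
Qed.

(** Monotonicity beyond the maximum at 2, without derivatives: y <= y0 (1 + (y - y0) / 2) when y0 >=
    2, and e^z >= 1 + z. *)
Lemma mul_expRN_half_le (y0 y : R) : 2 <= y0 -> y0 <= y ->
  y * expR (- (y / 2)) <= y0 * expR (- (y0 / 2)).
Proof.
move=> h2 hy; have y00 : 0 < y0 by lra.
rewrite (_ : - (y0 / 2) = - (y / 2) + (y - y0) / 2); last by field.
rewrite expRD mulrCA mulrC ler_wpM2l ?expR_ge0//.
apply: (@le_trans _ _ (y0 * (1 + (y - y0) / 2))); last by rewrite ler_wpM2l ?expR_ge1Dx// ltW.
have : 0 <= (y - y0) * (y0 - 2) by rewrite mulr_ge0 ?subr_ge0.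
lra.
Qed.

(* Everything below is expressed through the fourth root [s] of [ln n]: then
   [ln (ln n) <= 4 * s], so all the comparisons become polynomial in [s]. *)
Definition root4_ln (n : nat) : R := Num.sqrt (Num.sqrt (ln n%:R)).

Lemma cvgy_ln : ln (x : R) @[x --> +oo] --> +oo.
Proof.
apply/cvgryPge => A; near=> x.
have x0 : 0 < x by near: x; exact: nbhs_pinfty_gt.
by rewrite -ler_expR lnK ?posrE//; near: x; exact: nbhs_pinfty_ge.
Unshelve. all: by end_near. Qed.

Lemma cvgy_ln_nat : ln (n%:R : R) @[n --> \oo] --> +oo.
Proof. by have := cvg_comp _ _ (@cvgr_idn R) cvgy_ln; exact. Qed.

Lemma cvgy_root4_ln : root4_ln n @[n --> \oo] --> +oo.
Proof.
have := cvg_comp _ _ (cvg_comp _ _ cvgy_ln_nat (@cvgy_sqrt R)) (@cvgy_sqrt R).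
exact.
Qed.

Lemma root4_ln_facts (n : nat) (s := root4_ln n) (l := ln n%:R : R) : 1 <= s ->
  [/\ l = s ^+ 4, 0 < n%:R :> R, 1 <= l & 0 <= ln l <= 4 * s].
Proof.
move=> s1; have l0 : 0 < l.
  rewrite ltNge; apply/negP => /ler0_sqrtr l0.
  by move: s1; rewrite /s /root4_ln -/l l0 sqrtr0; lra.
have ls : l = s ^+ 4.
  by rewrite (_ : 4 = 2 * 2)%N// exprM /s /root4_ln !sqr_sqrtr ?sqrtr_ge0// ltW.
have l1 : 1 <= l by rewrite ls exprn_ege1.
split => //.
  rewrite ltr0n lt0n; apply: contraTneq l0 => n0.
  by rewrite /l n0 ln0// ltxx.
rewrite ln_ge0//= ls lnXn; last by lra.
by rewrite -[ln s *+ 4]mulr_natl ler_wpM2l// ln_le_self//; lra.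
Qed.

Lemma pow4_ge (s a : R) : 1 <= s -> a <= s -> a * s <= s ^+ 4.
Proof.
move=> s1 as_; have s0 : 0 <= s by lra.
apply: (@le_trans _ _ (s * s)); first by rewrite ler_wpM2r.
by rewrite -expr2 -[leLHS]mul1r (_ : 4 = 2 + 2)%N// exprD ler_wpM2r ?sqr_ge0// exprn_ege1.
Qed.

End Thresholds.

(** * The two thresholds and their distance to the detection boundary *)

Section ThresholdAsymptotics.
Context {R : realType}.
Local Notation peak := (normal_peak (1 : R)).

(** With kap = ln (2 C c) this solves C alpha_n e^(x^2/2) = 1/2, where the upper bound on the
    shrinkage mean at the largest tau reaches 1/2. *)
Definition lower_threshold (delta3 kap : R) (n : nat) : R :=
  Num.sqrt (2 * (ln n%:R - delta3 * ln (ln n%:R) - kap)).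

(** Here x^2 e^(-x^2/2) is of order 1 / (n log n). The coefficient 2 of log log n would only give
    order 1 / n; the spare logarithm beats any constant [c2]. *)
Definition upper_threshold (n : nat) : R :=
  Num.sqrt (2 * ln n%:R + 4 * ln (ln n%:R)).

Context (n : nat).
Local Notation s := (@root4_ln R n).
Local Notation l := (@ln R n%:R).

(** This also certifies that the radicand is nonnegative, so that squaring the threshold recovers
    it. *)
Lemma lower_threshold_sqr_ge delta3 kap : 0 < delta3 < 2^-1 -> 4 + `|kap| <= s ->
  (s ^+ 2) ^+ 2 <= 2 * (l - delta3 * ln l - kap).
Proof.
move=> /andP[d0 d1] sk; have k0 := normr_ge0 kap; have kk := ler_norm kap.
have s1 : 1 <= s by lra.
have [ls n0 l1 /andP[v0 v4]] := root4_ln_facts s1.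
have h := @pow4_ge R s (4 + `|kap|) s1 sk.
have e : delta3 * ln l <= 2^-1 * ln l by rewrite ler_wpM2r// ltW.
have : 4 * `|kap| <= s * `|kap| by rewrite ler_wpM2r//; lra.
have s4 : (s ^+ 2) ^+ 2 = l by rewrite -exprM ls.
rewrite -ls in h; lra.
Qed.

Lemma expR_lower_threshold delta3 kap : 0 < delta3 < 2^-1 -> 4 + `|kap| <= s ->
  expR (lower_threshold delta3 kap n ^+ 2 / 2) = n%:R / (l `^ delta3 * expR kap).
Proof.
move=> hd sk; have k0 := normr_ge0 kap; have s1 : 1 <= s by lra.
have [ls n0 l1 /andP[v0 v4]] := root4_ln_facts s1.
rewrite sqr_sqrtr; last by rewrite (le_trans _ (lower_threshold_sqr_ge hd sk))// sqr_ge0.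
rewrite mulrAC mulfV// mul1r -addrA -opprD expRB expRD lnK ?posrE//.
by rewrite /powR gt_eqF// (lt_le_trans ltr01 l1).
Qed.

Lemma lower_threshold_spec C c delta3 x : 0 < C -> 0 < c -> 0 < delta3 < 2^-1 ->
  4 + `|ln (2 * C * c)| <= s -> `|x| <= lower_threshold delta3 (ln (2 * C * c)) n ->
  C * (c * l `^ delta3 / n%:R) * expR (x ^+ 2 / 2) <= 2^-1.
Proof.
move=> C0 c0 hd sk xlo; have k0 := normr_ge0 (ln (2 * C * c)); have s1 : 1 <= s by lra.
have [ls n0 l1 /andP[v0 v4]] := root4_ln_facts s1.
have p0 : 0 < l `^ delta3 by rewrite powR_gt0//; exact: lt_le_trans l1.
have Cc0 : 0 < 2 * C * c by rewrite !mulr_gt0.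
apply: (@le_trans _ _ (C * (c * l `^ delta3 / n%:R) *
    expR (lower_threshold delta3 (ln (2 * C * c)) n ^+ 2 / 2))).
  rewrite ler_wpM2l//; first by rewrite ltW// !mulr_gt0// invr_gt0.
  rewrite ler_expR ler_pM2r// -real_normK ?num_real//.
  by rewrite lerXn2r ?nnegrE// sqrtr_ge0.
rewrite expR_lower_threshold// lnK ?posrE// le_eqVlt; apply/orP; left; apply/eqP.
by field; rewrite !gt_eqF.
Qed.

Lemma lower_threshold_ge delta3 kap : 0 < delta3 < 2^-1 -> 4 + `|kap| <= s ->
  s ^+ 2 <= lower_threshold delta3 kap n.
Proof.
move=> hd sk; rewrite -[leLHS]ger0_norm ?sqr_ge0// -sqrtr_sqr ler_wsqrtr//.
exact: lower_threshold_sqr_ge.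
Qed.

(** At this threshold n e^(-lo^2/2) = 2 C c l^delta3, and the factor 1 / lo <= l^(-1/2) of the Mills
    bound turns this into a negative power of l. *)
Lemma lower_threshold_tail C c delta3 : 0 < C -> 0 < c -> 0 < delta3 < 2^-1 ->
  4 + `|ln (2 * C * c)| <= s ->
  n%:R * (2 * Phi (- lower_threshold delta3 (ln (2 * C * c)) n)) <=
  4 * peak * C * c * expR (- ((2^-1 - delta3) * ln l)).
Proof.
move=> C0 c0 hd sk; have k0 := normr_ge0 (ln (2 * C * c)); have s1 : 1 <= s by lra.
have [ls n0 l1 /andP[v0 v4]] := root4_ln_facts s1.
have p0 := normal_peak_ge0 (1 : R).
have s20 : 0 < s ^+ 2 by rewrite exprn_gt0//; lra.
have l0 : 0 < l by exact: lt_le_trans l1.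
have pw0 : 0 < l `^ delta3 by rewrite powR_gt0.
have Cc0 : 0 < 2 * C * c by rewrite !mulr_gt0.
have lo_ge := lower_threshold_ge hd sk.
set lo := lower_threshold _ _ _ in lo_ge *.
have lo0 : 0 < lo by exact: lt_le_trans lo_ge.
have s2E : s ^+ 2 = expR (2^-1 * ln l).
  have s0 : 0 < s by lra.
  have -> : 2^-1 * ln l = ln (s ^+ 2).
    by rewrite ls !lnXn// -[_ *+ 4]mulr_natl -[_ *+ 2]mulr_natl; field.
  by rewrite lnK ?posrE.
have pwE : l `^ delta3 = expR (delta3 * ln l) by rewrite /powR gt_eqF.
have eE : expR (- (lo ^+ 2 / 2)) = l `^ delta3 * (2 * C * c) / n%:R.
  by rewrite expRN expR_lower_threshold// lnK ?posrE// invf_div.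
have rE : expR (- ((2^-1 - delta3) * ln l)) = l `^ delta3 / s ^+ 2.
  by rewrite pwE s2E -expRB; congr expR; ring.
rewrite rE; apply: (@le_trans _ _ (n%:R * (2 * (peak * (expR (- (lo ^+ 2 / 2)) / lo))))).
  by rewrite ler_wpM2l ?(ltW n0)// ler_wpM2l// normal_tail_le.
rewrite eE; have -> : n%:R * (2 * (peak * (l `^ delta3 * (2 * C * c) / n%:R / lo))) =
    4 * peak * C * c * (l `^ delta3 / lo) by field; rewrite !gt_eqF.
rewrite ler_wpM2l//.
  by apply: mulr_ge0 (ltW c0); apply: mulr_ge0 (ltW C0); apply: mulr_ge0.
by rewrite ler_wpM2l ?(ltW pw0)// lef_pV2 ?posrE.
Qed.

Lemma upper_threshold_spec c2 Y0 x : 0 < c2 -> 1 <= Y0 -> 18 / c2 + Y0 + 4 <= s ->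
  upper_threshold n <= `|x| ->
  Y0 <= x ^+ 2 /\ x ^+ 2 * expR (- (x ^+ 2 / 2)) <= c2 * n%:R^-1.
Proof.
move=> c20 Y1 hs hx; have c18 : 0 < 18 / c2 by rewrite divr_gt0.
have s1 : 1 <= s by lra.
have [ls n0 l1 /andP[v0 v4]] := root4_ln_facts s1.
have l0 : 0 < l by exact: lt_le_trans l1.
have y00 : 0 <= 2 * l + 4 * ln l by lra.
have hy : 2 * l + 4 * ln l <= x ^+ 2.
  rewrite -(sqr_sqrtr y00) -[leRHS]real_normK ?num_real//.
  by rewrite lerXn2r ?nnegrE ?sqrtr_ge0.
have hsl : (18 / c2 + Y0 + 4) * s <= l by rewrite ls; exact: pow4_ge.
have sl : s <= l.
  by apply: le_trans hsl; rewrite ler_peMl//; lra.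
have cl : 18 / c2 <= l by lra.
split; first by lra.
apply: (le_trans (mul_expRN_half_le _ hy)); first by lra.
have -> : - ((2 * l + 4 * ln l) / 2) = - (l + (ln l + ln l)) by field.
rewrite expRN !expRD !lnK ?posrE// .
rewrite invfM mulrA mulrAC ler_wpM2r ?invr_ge0 ?(ltW n0)//.
rewrite ler_pdivrMr ?mulr_gt0//.
(* Since 4 ln l <= 16 s <= 16 l, the squared threshold is at most 18 l. *)
apply: (@le_trans _ _ (18 * l)); first by lra.
by rewrite mulrA ler_wpM2r ?(ltW l0)// mulrC -ler_pdivrMr.
Qed.

Context (q : nat) (delta2 c1 c1' : R) (hq0 : (0 < q)%N) (hd2 : 0 < delta2) (hc1 : 0 < c1)
  (hq : c1 <= q%:R / l `^ delta2 <= c1').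
Local Notation S := (@Num.sqrt R (2 * ln (n%:R / q%:R))).
Context (Q : R) (Q0 : 0 <= Q) (hQ1 : - Q <= ln c1) (hQ2 : ln c1' <= Q).

Lemma ln_sparsity : 1 <= s -> `|ln (q%:R : R)| <= Q + delta2 * ln l.
Proof.
move=> s1; have [ls n0 l1 /andP[v0 v4]] := root4_ln_facts s1.
have l0 : 0 < l by exact: lt_le_trans l1.
have pw0 : 0 < l `^ delta2 by rewrite powR_gt0.
have qR0 : 0 < (q%:R : R) by rewrite ltr0n.
have /andP[h1 h2] := hq.
have lnE : ln (q%:R / l `^ delta2) = ln q%:R - delta2 * ln l.
  by rewrite ln_div ?posrE// ln_powR.
have r0 : 0 < q%:R / l `^ delta2 by rewrite divr_gt0.
have g1 : ln c1 <= ln (q%:R / l `^ delta2) by rewrite ler_ln ?posrE.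
have g2 : ln (q%:R / l `^ delta2) <= ln c1' by rewrite ler_ln ?posrE// (lt_le_trans r0).
rewrite lnE in g1 g2.
have dv : 0 <= delta2 * ln l by rewrite mulr_ge0// ltW.
have h3 := hQ1; have h4 := hQ2; rewrite ler_norml; apply/andP; split; lra.
Qed.

Lemma detection_boundary_ge : 4 + 8 * delta2 + 2 * Q <= s ->
  (s ^+ 2) ^+ 2 <= 2 * (l - ln (q%:R : R)).
Proof.
have Q_ge0 := Q0; have d2_gt0 := hd2.
move=> hs; have s1 : 1 <= s by lra.
have [ls n0 l1 /andP[v0 v4]] := root4_ln_facts s1.
have h := @pow4_ge R s (4 + 8 * delta2 + 2 * Q) s1 hs.
have := ler_norm (ln (q%:R : R)); have := ln_sparsity s1.
have e1 : delta2 * ln l <= delta2 * (4 * s) by rewrite ler_wpM2l// ltW.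
have e2 : 2 * Q <= 2 * Q * s by rewrite ler_peMr//; lra.
have s4 : (s ^+ 2) ^+ 2 = l by rewrite -exprM ls.
rewrite -ls in h; lra.
Qed.

Lemma detection_boundaryE : 1 <= s -> S = Num.sqrt (2 * (l - ln (q%:R : R))).
Proof.
move=> s1; have [_ n0 _ _] := root4_ln_facts s1.
have q1 : 0 < q%:R :> R by rewrite ltr0n.
by rewrite ln_div ?posrE.
Qed.

(** This makes S + b eventually positive, as the worst-case parameter requires. *)
Lemma detection_boundary_lower : 4 + 8 * delta2 + 2 * Q <= s -> s <= S.
Proof.
have Q_ge0 := Q0; have d2_gt0 := hd2.
move=> hs; have s1 : 1 <= s by lra.
rewrite detection_boundaryE//; apply: (@le_trans _ _ (s ^+ 2)).
  by rewrite expr2 ler_peMr//; lra.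
rewrite -[leLHS]ger0_norm ?sqr_ge0// -sqrtr_sqr ler_wsqrtr//.
exact: detection_boundary_ge.
Qed.

Lemma div_sqr_le (a A : R) : 1 <= s -> a <= A * s -> a / s ^+ 2 <= A / s.
Proof.
move=> s1 ha; have s0 : 0 < s by lra.
by rewrite expr2 invfM mulrA ler_wpM2r ?invr_ge0 ?(ltW s0)// ler_pdivrMr.
Qed.

(** The squares differ by 4 ln l + 2 ln q, which is O(s), while the threshold is at least s^2;
    dividing by the sum of the roots leaves O(1 / s). *)
Lemma upper_threshold_dist : 4 + 8 * delta2 + 2 * Q <= s ->
  `|upper_threshold n - S| <= (16 + 8 * delta2 + 2 * Q) / s.
Proof.
have Q_ge0 := Q0; have d2_gt0 := hd2.
move=> hs; have s1 : 1 <= s by lra.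
have [ls n0 l1 /andP[v0 v4]] := root4_ln_facts s1.
have s4 : (s ^+ 2) ^+ 2 = l by rewrite -exprM ls.
have s20 : 0 < s ^+ 2 by rewrite exprn_gt0//; lra.
have dv : delta2 * ln l <= delta2 * (4 * s) by rewrite ler_wpM2l// ltW.
have Qs : 2 * Q <= 2 * Q * s by rewrite ler_peMr//; lra.
have lq := ln_sparsity s1.
rewrite detection_boundaryE// /upper_threshold.
apply: le_trans (sqrt_dist_le s20 _ _) _.
- by rewrite s4; lra.
- exact: le_trans (sqr_ge0 _) (detection_boundary_ge hs).
apply: div_sqr_le => //; rewrite ler_norml; move: lq; rewrite ler_norml => /andP[? ?].
by apply/andP; split; lra.
Qed.

Lemma lower_threshold_dist delta3 kap : 0 < delta3 < 2^-1 ->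
  4 + `|kap| + 8 * delta2 + 2 * Q <= s ->
  `|lower_threshold delta3 kap n - S| <= (4 + 2 * `|kap| + 8 * delta2 + 2 * Q) / s.
Proof.
have Q_ge0 := Q0; have d2_gt0 := hd2.
move=> hd hs; have k0 := normr_ge0 kap.
have s1 : 1 <= s by lra.
have [ls n0 l1 /andP[v0 v4]] := root4_ln_facts s1.
have s20 : 0 < s ^+ 2 by rewrite exprn_gt0//; lra.
have dv : delta2 * ln l <= delta2 * (4 * s) by rewrite ler_wpM2l// ltW.
have Qs : 2 * Q <= 2 * Q * s by rewrite ler_peMr//; lra.
have ks : 2 * `|kap| <= 2 * `|kap| * s by rewrite ler_peMr//; lra.
have lq := ln_sparsity s1.
rewrite detection_boundaryE// /lower_threshold.
apply: le_trans (sqrt_dist_le s20 _ _) _.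
- by apply: lower_threshold_sqr_ge => //; lra.
- by apply: le_trans (sqr_ge0 _) (detection_boundary_ge _); lra.
have /andP[d0 d1] := hd.
have e0 : 0 <= delta3 * ln l by rewrite mulr_ge0// ltW.
have e1 : delta3 * ln l <= 2^-1 * ln l by rewrite ler_wpM2r// ltW.
have kk := ler_norm kap; have kk' := ler_norm (- kap); rewrite normrN in kk'.
apply: div_sqr_le => //; rewrite ler_norml; move: lq; rewrite ler_norml => /andP[? ?].
by apply/andP; split; lra.
Qed.

End ThresholdAsymptotics.

(** The bounds on the shrinkage mean assume tau <= 1. Here n = e^l >= (l / 2)^2 >= c l >= c
    l^delta3, using l >= 4 c. *)
Lemma prior_range_le1 {R : realType} (n : nat) (c delta3 : R) : 0 < c -> 0 < delta3 < 2^-1 ->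
  1 + 4 * c <= @root4_ln R n -> c * ln (n%:R : R) `^ delta3 / n%:R <= 1.
Proof.
move=> c0 /andP[d0 d1] hs; have s1 : 1 <= @root4_ln R n by lra.
have [ls n0 l1 _] := root4_ln_facts s1.
have hsl := pow4_ge s1 hs; rewrite -ls in hsl.
set l := ln _ in ls l1 hsl *.
have l0 : 0 < l by lra.
have cl : 4 * c <= l.
  by apply: le_trans hsl; rewrite (@le_trans _ _ (1 + 4 * c)) ?lerDr// ler_peMr//; lra.
rewrite ler_pdivrMr// mul1r -(lnK (x := n%:R)) ?posrE// -/l.
apply: (@le_trans _ _ (c * l)).
  rewrite ler_wpM2l ?(ltW c0)// -[leRHS]powRr1 ?(ltW l0)//.
  by apply: ler_powR => //; lra.
have -> : l = l / 2 + l / 2 by field.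
rewrite expRD.
have h : l / 2 <= expR (l / 2) by rewrite (le_trans _ (expR_ge1Dx _))// lerDr.
apply: (@le_trans _ _ ((l / 2) * (l / 2))); last by apply: ler_pM => //; lra.
nra.
Qed.

(** * The risk squeezed between vanishing sequences, uniformly in b *)

Theorem theorem3 (R : realType)
  (* sparsity level *)
  (q : nat -> nat) (delta2 : R)
  (hq_pos : forall n, (0 < q n)%N)
  (hq_sparse : (q n)%:R / n%:R @[n --> \oo] --> (0 : R))
  (hdelta2 : 0 < delta2)
  (hq_order : same_order (fun n => (q n)%:R) (fun n => ln n%:R `^ delta2))
  (* local prior, with a = 1/2 *)
  (L : R -> R) (K : R)
  (hL_pos : forall t, 0 < t -> 0 < L t)
  (hL_meas : measurable_fun (`]0, +oo[%classic : set R) L)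
  (hL_cont : {within `]0, +oo[, continuous L})
  (hL_slow : slowly_varying L)
  (hK : 0 < K)
  (hpi1 : is_density (local_prior 2^-1 K L))
  (hA1 : exists c0 t0 : R,
     [/\ 0 < c0, 0 < t0 & forall t, t0 <= t -> c0 <= L t])
  (hA2 : exists M : R, 0 < M /\ forall t, 0 < t -> L t <= M)
  (* prior on the global parameter *)
  (c delta3 : R) (hc : 0 < c) (hdelta3 : 0 < delta3 < 2^-1)
  (alpha : nat -> R)
  (halpha : forall n, alpha n = c * ln n%:R `^ delta3 / n%:R)
  (pi2 : nat -> R -> R)
  (hpi2 : forall n, is_density (pi2 n))
  (hpi2_supp : \forall n \near \oo,
     (\int[lebesgue_measure]_(tau in `[(n%:R^-1)%R, alpha n])
        (pi2 n tau)%:E = 1)%E)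
  (* noise: for each n, an i.i.d. N(0,1) family on some probability space *)
  (d : nat -> measure_display) (T : forall n, measurableType (d n))
  (P : forall n, probability (T n) R)
  (eps : forall n, 'I_n -> {RV (P n) >-> R})
  (heps : forall n, iid_standard_normal (@eps n)) :
  let psi n := @full_bayes_rule R 2^-1 K L (pi2 n) (alpha n) n in
  let conclusion (b : nat -> R) :=
    (scaled_max_risk (@eps n) (psi n) (q n) (b n) - (1 - Phi (b n))%:E)%E
      @[n --> \oo] --> (0%E : \bar R) in
  (forall b : R, conclusion (fun _ => b)) /\
  (forall b : nat -> R, b n @[n --> \oo] --> +oo -> conclusion b).
Proof.
move=> psi conclusion.
have [c0 [t0 [hc0 ht0 hLc0]]] := hA1; have [M [_ hM]] := hA2.
have [C C0 hC] := shrinkage_mean_le hL_pos hL_meas hK hpi1 hM.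
have [c2 [Y0 [c20 Y1 hc2]]] :=
  shrinkage_mean_ge hL_pos hL_meas hK hpi1 hM hc0 ht0 hLc0.
have [c1 [c1' [c10 hq]]] := hq_order.
have [Q [Q0 Q1 Q2]] : exists Q : R, [/\ 0 <= Q, - Q <= ln c1 & ln c1' <= Q].
  exists (`|ln c1| + `|ln c1'|); rewrite addr_ge0//; split => //.
    by rewrite lerNl ler_wpDr// -normrN ler_norm.
  by rewrite ler_wpDl// ler_norm.
pose kap := ln (2 * C * c).
pose s n : R := root4_ln n.
pose r n := 4 * normal_peak 1 * C * c * expR (- ((2^-1 - delta3) * ln (ln (n%:R : R)))) +
  normal_peak 1 * ((16 + 8 * delta2 + 2 * Q) / s n) +
  normal_peak 1 * ((4 + 2 * `|kap| + 8 * delta2 + 2 * Q) / s n).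
have r_cvg : r n @[n --> \oo] --> (0 : R).
  have sV : (s n)^-1 @[n --> \oo] --> (0 : R).
    apply/gtr0_cvgV0; last exact: cvgy_root4_ln.
    by near=> n; near: n; move/cvgryPgt : (@cvgy_root4_ln R); exact.
  have e0 : expR (- ((2^-1 - delta3) * ln (ln (n%:R : R)))) @[n --> \oo] --> (0 : R).
    apply: (cvg_comp (fun n : nat => (2^-1 - delta3) * ln (ln (n%:R : R))) (fun y => expR (- y)));
      last exact: cvgr_expR.
    have d0 : 0 < 2^-1 - delta3 by case/andP: hdelta3; lra.
    have lnln : ln (ln (n%:R : R)) @[n --> \oo] --> +oo.
      exact: (cvg_comp _ _ (@cvgy_ln_nat R) (@cvgy_ln R)).
    have dy : (2^-1 - delta3) * y @[y --> +oo] --> +oo.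
      by apply: (gt0_cvgMry d0); exact: cvg_id.
    exact: (cvg_comp _ _ lnln dy).
  have -> : (0 : R) = 4 * normal_peak 1 * C * c * 0 +
      normal_peak 1 * ((16 + 8 * delta2 + 2 * Q) * 0) +
      normal_peak 1 * ((4 + 2 * `|kap| + 8 * delta2 + 2 * Q) * 0).
    by rewrite !mulr0 !addr0.
  apply: cvgD; first apply: cvgD.
  - by apply: cvgM => //; exact: cvg_cst.
  - by apply: cvgM; [exact: cvg_cst|apply: cvgM => //; exact: cvg_cst].
  - by apply: cvgM; [exact: cvg_cst|apply: cvgM => //; exact: cvg_cst].
(* The error [r] does not involve b, whose only constraint is S + b > 0; an eventual lower bound on
   b is what the two cases have in common. *)
suff main (b : nat -> R) (B : R) : (\forall n \near \oo, - B <= b n) -> conclusion b.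
  split=> [b|b hb].
    by apply: (main _ (- b)); apply: nearW => n; rewrite opprK.
  by apply: (main _ 0); move/cvgryPge : hb => /(_ (- 0)).
move=> hb; rewrite /conclusion.
apply: (@squeeze_cvge _ _ _ _ (fun n => (- r n)%:E) _ (fun n => (r n)%:E)).
- have p0 := normal_peak_ge0 (1 : R).
  (* The sum of all the sizes demanded of [s n], so that one eventual inequality serves every lemma;
     the last two terms ensure s n + b n > 0. *)
  pose B0 := 18 / c2 + Y0 + 4 + `|kap| + 8 * delta2 + 2 * Q + 4 * c + `|B| + 1.
  have kap0 := normr_ge0 kap; have Babs := normr_ge0 B; have Ble := ler_norm B.
  have c18 : 0 < 18 / c2 by rewrite divr_gt0.
  near=> n.
  have sB : B0 <= s n by near: n; move/cvgryPge : (@cvgy_root4_ln R); exact.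
  have hn : (0 < n)%N by near: n; exact: nbhs_infty_gt.
  have bB : - B <= b n by near: n.
  have hqn : c1 <= (q n)%:R / ln n%:R `^ delta2 <= c1' by near: n; exact: hq.
  have pin : (\int[lebesgue_measure]_(tau in `[(n%:R^-1)%R, alpha n]) (pi2 n tau)%:E = 1)%E.
    by near: n.
  have qn : (q n <= n)%N.
    have : `|0 - (q n)%:R / n%:R| < 1 :> R.
      by near: n; move/cvgrPdist_lt : hq_sparse; apply.
    rewrite sub0r normrN ger0_norm ?divr_ge0// ltr_pdivrMr ?ltr0n// mul1r ltr_nat.
    exact: ltnW.
  have s4 : 4 + `|kap| <= s n by move: sB; rewrite /B0; lra.
  have s8 : 4 + `|kap| + 8 * delta2 + 2 * Q <= s n by move: sB; rewrite /B0; lra.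
  have s9 : 4 + 8 * delta2 + 2 * Q <= s n by move: sB; rewrite /B0; lra.
  have s18 : 18 / c2 + Y0 + 4 <= s n by move: sB; rewrite /B0; lra.
  have sc : 1 + 4 * c <= s n by move: sB; rewrite /B0; lra.
  have sb : 0 < s n + b n by move: sB; rewrite /B0; lra.
  have sn1 : 1 <= s n by lra.
  have alpha1 : alpha n <= 1 by rewrite halpha; exact: prior_range_le1.
  have tau_bounds tau : n%:R^-1 <= tau <= alpha n -> 0 < tau <= 1.
    move=> /andP[h1 h2]; rewrite (le_trans h2 alpha1) andbT.
    by rewrite (lt_le_trans _ h1)// invr_gt0 ltr0n.
  have lo0 : 0 < lower_threshold delta3 kap n.
    by apply: lt_le_trans (lower_threshold_ge hdelta3 s4); rewrite exprn_gt0// (lt_le_trans ltr01 sn1).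
  have psi_lo (X : 'rV[R]_n) (i : 'I_n) :
      `|X 0 i| <= lower_threshold delta3 kap n -> psi n X i = false.
    move=> hX; apply: (full_bayes_rule_false hL_pos hL_meas hK hpi1) => // tau htau.
    apply: (le_trans (hC (X 0 i) tau (tau_bounds _ htau))).
    apply: le_trans (lower_threshold_spec C0 hc hdelta3 s4 hX).
    rewrite ler_wpM2r ?expR_ge0// ler_wpM2l ?(ltW C0)// -halpha.
    by case/andP: htau.
  have psi_hi (X : 'rV[R]_n) (i : 'I_n) : upper_threshold n <= `|X 0 i| -> psi n X i.
    move=> hX; apply: (full_bayes_rule_true hL_pos hL_meas hK hpi1) => // tau htau.
    have [hY hexp] := upper_threshold_spec c20 Y1 s18 hX.
    apply: hc2 => //; first exact: tau_bounds.
    by rewrite (le_trans hexp)// ler_wpM2l ?(ltW c20)//; case/andP: htau.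
  have Sb0 : 0 < Num.sqrt (2 * ln (n%:R / (q n)%:R)) + b n.
    have := detection_boundary_lower (hq_pos n) hdelta2 c10 hqn Q0 Q1 Q2 s9.
    by rewrite -/(s n); move: sb; lra.
  have q0n : (0 < q n <= n)%N by rewrite hq_pos.
  have /andP[h1 h2] := scaled_max_risk_bounds (heps n) lo0 psi_lo psi_hi q0n Sb0.
  set r' := (X in (_ <= X%:E)%E) in h2; rewrite -/r' in h1.
  have rr : r' <= r n.
    rewrite /r' /r; apply: lerD; first apply: lerD.
    - exact: lower_threshold_tail.
    - rewrite ler_wpM2l//.
      exact: (upper_threshold_dist (hq_pos n) hdelta2 c10 hqn Q0 Q1 Q2 s9).
    - rewrite ler_wpM2l//.
      exact: (lower_threshold_dist (hq_pos n) hdelta2 c10 hqn Q0 Q1 Q2 hdelta3 s8).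
  by rewrite (le_trans _ h1) ?(le_trans h2)// ?lee_fin ?lerN2.
- apply: cvg_EFin; first exact: nearW.
  by rewrite -[X in _ --> X]oppr0; apply: (cvgN r_cvg).
- by apply: cvg_EFin; first exact: nearW.
Unshelve. all: by end_near. Qed.
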